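(* Let $(\sigma,\eta,\rho)$ be Blaschke interpolation data of type $(n,k)$, and let $(\sigma,\eta,\tilde\eta,\rho)$ be royal tetra-interpolation data of type $(n,k)$, where $\tilde\eta=(\tilde\eta_1,\dots,\tilde\eta_n)$, $\tilde\eta_j\in\mathbb T$ for $j=1,\dots,k$ and $\tilde\eta_j\in\mathbb D$ for $j=k+1,\dots,n$. Suppose that the Blaschke interpolation problem with data $(\sigma,\eta,\rho)$ is solvable and that its solutions $\varphi$ have normalized linear fractional parametrization $$\varphi=\frac{a\zeta+b}{c\zeta+d}.$$ Suppose that there exist scalars $x_1^\circ,x_2^\circ,x_3^\circ\in\mathbb C$ such that $$|x_3^\circ|=1,\quad |x_1^\circ|<1,\quad |x_2^\circ|<1,\quad x_1^\circ=\overline{x_2^\circ}\,x_3^\circ,$$ and $$\frac{x_3^\circ c(\sigma_j)+x_2^\circ d(\sigma_j)}{x_1^\circ c(\sigma_j)+d(\sigma_j)}=\tilde\eta_j,\quad j=1,\dots,n.$$ Then there exists a rational tetra-inner function $x=(x_1,x_2,x_3)$ given, for $\lambda\in\mathbb D$, by $$x_1(\lambda)=\frac{x_1^\circ a(\lambda)+b(\lambda)}{x_1^\circ c(\lambda)+d(\lambda)},\quad x_2(\lambda)=\frac{x_3^\circ c(\lambda)+x_2^\circ d(\lambda)}{x_1^\circ c(\lambda)+d(\lambda)},\quad x_3(\lambda)=\frac{x_2^\circ b(\lambda)+x_3^\circ a(\lambda)}{x_1^\circ c(\lambda)+d(\lambda)},$$ such that (i) $x\in\mathcal R^{n,k}$,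 and $x$ is a solution of the royal tetra-interpolation problem with data $(\sigma,\eta,\tilde\eta,\rho)$, that is, $x(\sigma_j)=(\eta_j,\tilde\eta_j,\eta_j\tilde\eta_j)$ for $j=1,\dots,n$ and $Ax_1(\sigma_j)=\rho_j$ for $j=1,\dots,k$; (ii) for all but finitely many $\omega\in\mathbb T$, the function $\Psi_\omega\circ x$ is a solution of the Blaschke interpolation problem with data $(\sigma,\eta,\rho)$.
   Context: $\mathbb D$ is the open unit disc in $\mathbb C$, $\overline{\mathbb D}$ its closure, $\mathbb T$ the unit circle. Closed tetrablock: $\overline{\mathcal E}=\{(x_1,x_2,x_3)\in\mathbb C^3: 1-x_1z-x_2w+x_3zw\neq 0 \text{ whenever } |z|<1,|w|<1\}$. Its distinguished boundary (smallest closed boundary) is $b\overline{\mathcal E}=\{x\in\mathbb C^3: x_1=\overline{x_2}x_3,\ |x_3|=1,\ |x_2|\le 1\}$. Royal variety: $\mathcal R_{\overline{\mathcal E}}=\{(x_1,x_2,x_3)\in\overline{\mathcal E}: x_3=x_1x_2\}$. A rational tetra-inner (or $\overline{\mathcal E}$-inner) function is an analytic map $x=(x_1,x_2,x_3):\mathbb D\to\overline{\mathcal E}$ with rational components such that $\lim_{r\uparrow1}x(r\lambda)\in b\overline{\mathcal E}$ for almost all $\lambda\in\mathbb T$; it extends continuously to $\overline{\mathbb D}$. Its degree is the topological degree of $x|_{\mathbb T}:\mathbb T\to b\overline{\mathcal E}$ (where $\pi_1(b\overline{\mathcal E})\cong\mathbb Z$); it equals the degree of the finite Blaschke product $x_3$.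 For $\omega\in\mathbb T$, $\Psi_\omega(x_1,x_2,x_3)=\frac{x_3\omega-x_1}{x_2\omega-1}$ when $x_2\omega\ne1$; $\Psi_\omega\circ x$ is regarded as a rational function on $\overline{\mathbb D}$. Royal nodes and type: if $x$ is a rational $\overline{\mathcal E}$-inner function of degree $m$, there are polynomials $E_1,E_2,D$ of degree at most $m$, with $D$ nonvanishing on $\overline{\mathbb D}$, such that $x_1=E_1/D$, $x_2=E_2/D$, $x_3=D^{\sim m}/D$, where $D^{\sim m}(\lambda)=\lambda^m\overline{D(1/\overline\lambda)}$. The royal polynomial is $R_x=DD^{\sim m}-E_1E_2$. The royal nodes of $x$ are the points $\sigma\in\overline{\mathbb D}$ with $x(\sigma)\in\mathcal R_{\overline{\mathcal E}}$, equivalently the zeros of $R_x$ in $\overline{\mathbb D}$. When $x(\overline{\mathbb D})\nsubseteq\mathcal R_{\overline{\mathcal E}}$, a royal node $\sigma$ that is a zero of $R_x$ of order $\ell$ has multiplicity $\ell$ if $\sigma\in\mathbb D$ and $\ell/2$ if $\sigma\in\mathbb T$; $x$ has type $(n,k)$ if it has $n$ royal nodes in $\overline{\mathbb D}$ and $k$ royal nodes in $\mathbb T$, counted with multiplicity. $\mathcal R^{n,k}$ denotes the collection of rational $\overline{\mathcal E}$-inner functions $x$ with $x(\overline{\mathbb D})\nsubseteq\mathcal R_{\overline{\mathcal E}}$ of type $(n,k)$. Phasar derivative: if $f$ is a differentiable function on $\mathbb T$, nonvanishing near $z=e^{i\theta}$, $Af(z)$ denotes the derivative with respect to $\theta$ of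 $\arg f(e^{i\theta})$ at $z$. Blaschke interpolation data of type $(n,k)$, $n\ge1$, $0\le k\le n$: a triple $(\sigma,\eta,\rho)$ where $\sigma=(\sigma_1,\dots,\sigma_n)$ consists of distinct points with $\sigma_j\in\mathbb T$ for $j\le k$ and $\sigma_j\in\mathbb D$ for $j>k$; $\eta=(\eta_1,\dots,\eta_n)$ with $\eta_j\in\mathbb T$ for $j\le k$ and $\eta_j\in\mathbb D$ for $j>k$; $\rho=(\rho_1,\dots,\rho_k)$ with $\rho_j>0$. Royal tetra-interpolation data of type $(n,k)$: a four-tuple $(\sigma,\eta,\tilde\eta,\rho)$ where $(\sigma,\eta,\rho)$ is Blaschke interpolation data of type $(n,k)$ and $\tilde\eta=(\tilde\eta_1,\dots,\tilde\eta_n)$ with $\tilde\eta_j\in\mathbb T$ for $j\le k$ and $\tilde\eta_j\in\mathbb D$ for $j>k$. Blaschke interpolation problem: find all rational inner functions $\varphi$ on $\mathbb D$ (finite Blaschke products) of degree $n$ with $\varphi(\sigma_j)=\eta_j$ for $j=1,\dots,n$ and $A\varphi(\sigma_j)=\rho_j$ for $j=1,\dots,k$. It is solvable if such a $\varphi$ exists. Royal tetra-interpolation problem: find all rational $\overline{\mathcal E}$-inner functions $x=(x_1,x_2,x_3)$ of degree $n$ with $x(\sigma_j)=(\eta_j,\tilde\eta_j,\eta_j\tilde\eta_j)$ for $j=1,\dots,n$ and $Ax_1(\sigma_j)=\rho_j$ for $j=1,\dots,k$. Normalized linear fractional parametrization of the solutions of a solvable Blaschke interpolation problem: an expression $\varphi=\frac{a\zeta+b}{c\zeta+d}$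 such that (1) $a,b,c,d$ are polynomials of degree at most $n$; (2) for all but at most $k$ values of $\zeta\in\mathbb T$ the function $\varphi(\lambda)=\frac{a(\lambda)\zeta+b(\lambda)}{c(\lambda)\zeta+d(\lambda)}$ is a solution of the problem; (3) for some $\tau\in\mathbb T\setminus\{\sigma_1,\dots,\sigma_k\}$, $\begin{bmatrix}a(\tau)&b(\tau)\\ c(\tau)&d(\tau)\end{bmatrix}=\begin{bmatrix}1&0\\0&1\end{bmatrix}$; (4) every solution $\varphi$ of the problem has this form for some $\zeta\in\mathbb T$. *)

(* Defs.v *)
From HB Require Import structures.
From mathcomp Require Import all_boot all_order all_algebra.
From mathcomp Require Import complex.
From mathcomp Require Import all_classical all_reals all_analysis.
Import Order.TTheory GRing.Theory Num.Theory.
Import numFieldNormedType.Exports.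

Set Implicit Arguments.
Unset Strict Implicit.
Unset Printing Implicit Defensive.

Local Open Scope classical_set_scope.
Local Open Scope ring_scope.

(* The usual topology of the complex plane: [R[i]] gets the normed module
   structure that every numFieldType carries over itself. *)
HB.instance Definition _ (R : realType) := NormedModule.copy R[i] (R[i]^o).

Notation C3 R := (R[i] * R[i] * R[i])%type.

Definition c1 {R : realType} (p : C3 R) : R[i] := p.1.1.
Definition c2 {R : realType} (p : C3 R) : R[i] := p.1.2.
Definition c3 {R : realType} (p : C3 R) : R[i] := p.2.

(* e^{it} *)
Definition cis {R : realType} (t : R) : R[i] := (cos t +i* sin t)%C.

Definition closed_tetrablock {R : realType} : set (C3 R) :=
  [set p | forall z w : R[i], `|z| < 1 -> `|w| < 1 ->
     1 - c1 p * z - c2 p * w + c3 p * z * w != 0].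

Definition tetra_boundary {R : realType} : set (C3 R) :=
  [set p | [/\ c1 p = (c2 p)^* * c3 p, `|c3 p| = 1 & `|c2 p| <= 1]].

Definition royal_variety {R : realType} : set (C3 R) :=
  [set p | closed_tetrablock p /\ c3 p = c1 p * c2 p].

(* A function on the open disc that is a quotient of polynomials without poles
   in the disc; in particular it is analytic there. *)
Definition rational_on_disc {R : realType} (f : R[i] -> R[i]) : Prop :=
  exists p q : {poly R[i]},
    forall z : R[i], `|z| < 1 -> q.[z] != 0 /\ f z = p.[z] / q.[z].

(* Rational inner maps are identified with their continuous extension to the
   closed disc, hence the last clause; values of [x] outside the closed disc
   are irrelevant everywhere. "Almost all points of the circle" is expressed
   through the parametrization [cis]. *)
Definition tetra_inner {R : realType} (x : R[i] -> C3 R) : Prop :=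
  [/\ [/\ rational_on_disc (c1 \o x), rational_on_disc (c2 \o x)
        & rational_on_disc (c3 \o x)],
      forall z, `|z| < 1 -> closed_tetrablock (x z),
      {ae (@lebesgue_measure R), forall t : R,
         exists2 l : C3 R, tetra_boundary l &
           x ((r%:C)%C * cis t) @[r --> (1 : R)^'-] --> l}
    & {within [set z : R[i] | `|z| <= 1], continuous x}].

(* Topological degree of [x] restricted to the circle, as a loop in the
   distinguished boundary: the free homotopy classes of such loops are those of
   z |-> (0, 0, z^m), the loop z |-> (0, 0, z) generating the fundamental
   group. *)
Definition tetra_degree {R : realType} (x : R[i] -> C3 R) (m : nat) : Prop :=
  exists H : R * R[i] -> C3 R,
    [/\ {within [set p | 0 <= p.1 <= 1 /\ `|p.2| = 1], continuous H},
        forall (t : R) (z : R[i]), 0 <= t <= 1 -> `|z| = 1 ->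
          tetra_boundary (H (t, z)),
        forall z : R[i], `|z| = 1 -> H (0, z) = x z
      & forall z : R[i], `|z| = 1 -> H (1, z) = (0, 0, z ^+ m)].

(* D^{~m}(z) = z^m * conj (D (1 / conj z)), for deg D <= m *)
Definition reflection {R : realType} (m : nat) (D : {poly R[i]}) :
    {poly R[i]} := \poly_(i < m.+1) (D`_(m - i))^*.

Definition royal_representation {R : realType} (x : R[i] -> C3 R) (m : nat)
    (E1 E2 D : {poly R[i]}) : Prop :=
  [/\ [/\ (size E1 <= m.+1)%N, (size E2 <= m.+1)%N & (size D <= m.+1)%N],
      forall z, `|z| <= 1 -> D.[z] != 0
    & forall z, `|z| <= 1 ->
        x z = (E1.[z] / D.[z], E2.[z] / D.[z], (reflection m D).[z] / D.[z])].

Definition royal_polynomial {R : realType} (m : nat) (E1 E2 D : {poly R[i]}) :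
    {poly R[i]} := D * reflection m D - E1 * E2.

Definition royal_node {R : realType} (x : R[i] -> C3 R) (s : R[i]) : Prop :=
  `|s| <= 1 /\ royal_variety (x s).

Definition royal_multiplicity {R : realType} (p : {poly R[i]}) (s : R[i]) :
    rat := if `|s| < 1 then (mup s p)%:R else (mup s p)%:R / 2.

Definition royal_type {R : realType} (x : R[i] -> C3 R) (n k : nat) : Prop :=
  exists (m : nat) (E1 E2 D : {poly R[i]}) (s : seq R[i]),
    let mult := royal_multiplicity (royal_polynomial m E1 E2 D) in
    [/\ tetra_degree x m, royal_representation x m E1 E2 D,
        uniq s /\ (forall z, z \in s <-> royal_node x z),
        \sum_(z <- s) mult z = n%:R
      & \sum_(z <- s | `|z| == 1) mult z = k%:R].

Definition royal_class {R : realType} (n k : nat) (x : R[i] -> C3 R) : Prop :=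
  [/\ tetra_inner x,
      ~ (x @` [set z | `|z| <= 1] `<=` royal_variety)
    & royal_type x n k].

(* A f(z) = rho, where [g] is a local determination of t |-> arg f(e^{it}).
   Continuity of [g] need not be assumed: differentiability at [t0] forces [g]
   to coincide near [t0] with a continuous branch. *)
Definition phasar_derivative {R : realType} (f : R[i] -> R[i]) (z : R[i])
    (rho : R) : Prop :=
  exists (t0 : R) (g : R -> R),
    [/\ cis t0 = z,
        \forall t \near t0, f (cis t) != 0 /\
          f (cis t) = `|f (cis t)| * cis (g t)
      & is_derive t0 1 g rho].

Definition blaschke_product {R : realType} (n : nat) (phi : R[i] -> R[i]) :
    Prop :=
  exists (gamma : R[i]) (alpha : 'I_n -> R[i]),
    [/\ `|gamma| = 1, forall i, `|alpha i| < 1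
      & forall z, `|z| <= 1 ->
          phi z = gamma * \prod_(i < n) ((z - alpha i) / (1 - (alpha i)^* * z))].

(* Indices are 0-based: the j-th node is on the circle when j < k. *)
Definition in_circle_disc {R : realType} (n k : nat) (v : 'I_n -> R[i]) :
    Prop :=
  forall j : 'I_n, if (j < k)%N then `|v j| = 1 else `|v j| < 1.

Definition blaschke_data {R : realType} (n k : nat) (sigma eta : 'I_n -> R[i])
    (rho : 'I_k -> R) : Prop :=
  [/\ injective sigma, in_circle_disc k sigma, in_circle_disc k eta
    & forall j, 0 < rho j].

Definition royal_data {R : realType} (n k : nat)
    (sigma eta teta : 'I_n -> R[i]) (rho : 'I_k -> R) : Prop :=
  blaschke_data sigma eta rho /\ in_circle_disc k teta.

Definition blaschke_solution {R : realType} (n k : nat) (hk : (k <= n)%N)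
    (sigma eta : 'I_n -> R[i]) (rho : 'I_k -> R) (phi : R[i] -> R[i]) : Prop :=
  [/\ blaschke_product n phi, forall j, phi (sigma j) = eta j
    & forall j, phasar_derivative phi (sigma (widen_ord hk j)) (rho j)].

Definition royal_solution {R : realType} (n k : nat) (hk : (k <= n)%N)
    (sigma eta teta : 'I_n -> R[i]) (rho : 'I_k -> R) (x : R[i] -> C3 R) :
    Prop :=
  [/\ tetra_inner x, tetra_degree x n,
      forall j, x (sigma j) = (eta j, teta j, eta j * teta j)
    & forall j, phasar_derivative (c1 \o x) (sigma (widen_ord hk j)) (rho j)].

(* [phi] is f / g as a rational function on the closed disc: they agree off a
   finite set, which covers the removable singularities of f / g. *)
Definition is_quotient {R : realType} (phi f g : R[i] -> R[i]) : Prop :=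
  exists s : seq R[i], forall z, `|z| <= 1 -> z \notin s ->
    g z != 0 /\ phi z = f z / g z.

Definition normalized_parametrization {R : realType} (n k : nat)
    (hk : (k <= n)%N) (sigma eta : 'I_n -> R[i]) (rho : 'I_k -> R)
    (a b c d : {poly R[i]}) : Prop :=
  let is_lft phi zeta := is_quotient phi
    (fun z => a.[z] * zeta + b.[z]) (fun z => c.[z] * zeta + d.[z]) in
  [/\ [/\ (size a <= n.+1)%N, (size b <= n.+1)%N, (size c <= n.+1)%N
        & (size d <= n.+1)%N],
      exists s : seq R[i], (size s <= k)%N /\
        forall zeta, `|zeta| = 1 -> zeta \notin s ->
          exists phi, blaschke_solution hk sigma eta rho phi /\
            is_lft phi zeta,
      exists tau : R[i],
        [/\ `|tau| = 1, forall j : 'I_n, (j < k)%N -> tau != sigma j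
          & [/\ a.[tau] = 1, b.[tau] = 0, c.[tau] = 0 & d.[tau] = 1]]
    & forall phi, blaschke_solution hk sigma eta rho phi ->
        exists zeta, `|zeta| = 1 /\ is_lft phi zeta].

Definition Psi {R : realType} (omega : R[i]) (p : C3 R) : R[i] :=
  (c3 p * omega - c1 p) / (c2 p * omega - 1).

(* [phi] is Psi_omega o x regarded as a rational function on the closed disc,
   removable singularities included. *)
Definition is_Psi_comp {R : realType} (omega : R[i]) (x : R[i] -> C3 R)
    (phi : R[i] -> R[i]) : Prop :=
  exists s : seq R[i], forall z, `|z| <= 1 -> z \notin s ->
    c2 (x z) * omega != 1 /\ phi z = Psi omega (x z).

(* Main.v *)
(** For all but finitely many [zeta] on the circle, coprimality and a degree
    count show that [a zeta + b] and [c zeta + d] are a common scalar multiple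
    of the numerator and the denominator of a Blaschke product of degree [n].
    With the normalization at [tau], this gives [a = (z/tau)^n conj d] and
    [b = (z/tau)^n conj c] on the circle. The set where [|c| = |d|] in the
    closed disc is finite, hence does not separate it, so [|c| <= |d|] there
    and [x1o c + d] has no zero. Since [|a zeta + b| <= |c zeta + d|] for
    [|zeta| <= 1], the identity
      [(x1o c + d) (1 - x1 z - x2 w + x3 z w)
         = (1 - x2o w) ((c zeta + d) - z (a zeta + b))],
    with [zeta = (x1o - x3o w) / (1 - x2o w)], places [x] in the tetrablock.
    The royal polynomial is a multiple of [a d - b c], which vanishes at the
    nodes, doubly at those on the circle, and is symmetric under reflection in
    the circle: this determines it up to a scalar. Finally [Psi_omega o x] is
    [(a zeta + b) / (c zeta + d)] with
    [zeta = (x3o omega - x1o) / (x2o omega - 1)]. *)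

Require Import Defs.
From HB Require Import structures.
From mathcomp Require Import all_boot all_order all_algebra.
From mathcomp Require Import complex ring lra.
From mathcomp Require Import all_classical all_reals all_analysis.
Import Order.TTheory GRing.Theory Num.Theory.
Import numFieldNormedType.Exports.
Set Implicit Arguments.
Unset Strict Implicit.
Unset Printing Implicit Defensive.
Local Open Scope classical_set_scope.
Local Open Scope ring_scope.

(** * Polynomials agreeing on the circle *)

Section Infinite.
Variable F : fieldType.

Lemma injective_avoid (f : nat -> F) (s : seq F) :
  injective f -> exists m, f m \notin s.
Proof.
move=> f_inj; have : has (fun m => f m \notin s) (iota 0 (size s).+1).
  apply: contraT; rewrite -all_predC => /allP fs.
  have : (size (map f (iota 0 (size s).+1)) <= size s)%N.
    apply: uniq_leq_size; first by rewrite map_inj_uniq ?iota_uniq.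
    by move=> x /mapP[m /fs /=]; rewrite negbK => ? ->.
  by rewrite size_map size_iota ltnn.
by case/hasP => m _ fm; exists m.
Qed.

Lemma poly_injective_roots (f : nat -> F) (p : {poly F}) :
  injective f -> (forall m, p.[f m] = 0) -> p = 0.
Proof.
move=> f_inj p0; apply/eqP; apply: contraT => pN0.
have := max_poly_roots pN0 (_ : all (root p) (map f (iota 0 (size p)))).
rewrite map_inj_uniq // iota_uniq size_map size_iota ltnn; apply => //.
by apply/allP => x /mapP[m _ ->]; apply/eqP.
Qed.

End Infinite.

Section Circle.
Variable C : numClosedFieldType.
Implicit Types (p q : {poly C}) (z : C).

Lemma norm1_conjC z : `|z| = 1 -> z^* = z^-1.
Proof. by move=> z1; rewrite invC_norm z1 expr1n invr1 mul1r. Qed.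

Lemma norm1_neq0 z : `|z| = 1 -> z != 0.
Proof. by move=> z1; rewrite -normr_eq0 z1 oner_eq0. Qed.

Lemma norm1_le1 z : `|z| = 1 -> `|z| <= 1.
Proof. by move->. Qed.

Lemma circle_avoid_near (s : seq C) (z0 e : C) : `|z0| = 1 -> 0 < e ->
  exists z, [/\ `|z| = 1, `|z - z0| < e & z \notin s].
Proof.
move=> z01 e0.
pose t (m : nat) : C := e / 4 / m.+1%:R.
have t0 m : 0 < t m by rewrite !divr_gt0 ?ltr0n.
have tR m : (t m)^* = t m by apply/CrealP; rewrite gtr0_real.
have NJ m : (1 - 'i * t m)^* = 1 + 'i * t m.
  by rewrite rmorphB rmorph1 rmorphM /= conjCi tR mulNr opprK.
have N2 m : `|1 - 'i * t m| ^+ 2 = 1 + t m ^+ 2.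
  by rewrite normCK NJ; ring: (sqrCi C).
have N1 m : 1 <= `|1 - 'i * t m|.
  by rewrite -(@expr_ge1 _ 2) // N2 lerDl exprn_ge0 // ltW.
have N0 m : 1 - 'i * t m != 0.
  by rewrite -normr_gt0 (lt_le_trans _ (N1 m)).
pose f m := z0 * ((1 + 'i * t m) / (1 - 'i * t m)).
have [|m fm] := @injective_avoid C f s.
  move=> m l /(mulfI (norm1_neq0 z01))/eqP; rewrite eqr_div // => /eqP E.
  have {}E : ('i * t m) * 2 = ('i * t l) * 2.
    by apply/eqP; rewrite -subr_eq0; apply/eqP; move/eqP: E;
      rewrite -subr_eq0 => /eqP <-; ring.
  move: E => /(mulIf _) E; have {}E := E ltac:(by rewrite pnatr_eq0).
  move/(mulfI (neq0Ci _)): E; rewrite /t => /(mulfI _) E.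
  have {}E := E ltac:(by rewrite mulf_neq0 ?invr_eq0 ?pnatr_eq0 ?gt_eqF).
  by move/invr_inj/eqP: E; rewrite eqr_nat eqSS => /eqP.
exists (f m); split => //.
  by rewrite normrM z01 mul1r normf_div -NJ norm_conjC divff // normr_eq0.
(* The distance is at most 2 t, and t <= e / 4, which leaves a factor 2 for strictness. *)
have -> : f m - z0 = z0 * (2 * 'i * t m / (1 - 'i * t m)).
  by rewrite /f; field.
rewrite normrM z01 mul1r normf_div ltr_pdivrMr ?normr_gt0 //.
apply: (@lt_le_trans _ _ e); last by rewrite ler_peMr // ltW.
rewrite !normrM normCi mulr1 !ger0_norm ?ltW // /t ?invr_gt0 ?ltr0n //.
rewrite mulrA ltr_pdivrMr ?ltr0n //.
apply: (@lt_le_trans _ _ e); last by rewrite ler_peMr ?ler1n // ltW.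
rewrite [X in _ < X](_ : e = 2 * (e / 2)); last by field.
by rewrite ltr_pM2l ?ltr0n // ltr_pM2l // ltf_pV2 ?posrE ?ltr0n // ltr_nat.
Qed.

Lemma circle_avoid (s : seq C) : exists z, `|z| = 1 /\ z \notin s.
Proof.
have [z [z1 _ zs]] := circle_avoid_near s (normr1 C) (@ltr01 C).
by exists z.
Qed.

(** The roots of a nonzero difference and the points of [s] form a finite set, which the circle
    avoids. The list [s] absorbs points where a quotient is not yet known to be defined. *)
Lemma poly_circle_eq (s : seq C) p q :
  (forall z, `|z| = 1 -> z \notin s -> p.[z] = q.[z]) -> p = q.
Proof.
move=> pq; apply/eqP; rewrite -subr_eq0; apply: contraT => r0.
have [rs Ers] := closed_field_poly_normal (p - q).
have [z [z1]] := circle_avoid (rs ++ s).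
rewrite mem_cat negb_or => /andP[zr zs]; case/negP: zr.
rewrite -root_prod_XsubC -(@rootZ _ _ (lead_coef (p - q))) ?lead_coef_eq0 //.
by rewrite -Ers rootE !hornerE pq // subrr.
Qed.

End Circle.

(** * Blaschke products as quotients of polynomials *)

Section BlaschkeQuotient.
Variables (C : numClosedFieldType) (n : nat).
Implicit Types (p q : {poly C}) (z : C) (alpha : 'I_n -> C).

Definition blaschke_num alpha : {poly C} := \prod_(i < n) ('X - (alpha i)%:P).

Definition blaschke_den alpha : {poly C} :=
  \prod_(i < n) (1 - (alpha i)^* *: 'X).

Lemma horner_blaschke_num alpha z :
  (blaschke_num alpha).[z] = \prod_(i < n) (z - alpha i).
Proof. by rewrite horner_prod; apply: eq_bigr => i _; rewrite !hornerE. Qed.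

Lemma horner_blaschke_den alpha z :
  (blaschke_den alpha).[z] = \prod_(i < n) (1 - (alpha i)^* * z).
Proof. by rewrite horner_prod; apply: eq_bigr => i _; rewrite !hornerE. Qed.

Lemma size_blaschke_num alpha : size (blaschke_num alpha) = n.+1.
Proof. by rewrite size_prod_XsubC /index_enum -enumT size_enum_ord. Qed.

Lemma blaschke_num_neq0 alpha : blaschke_num alpha != 0.
Proof. by rewrite -size_poly_gt0 size_blaschke_num. Qed.

Lemma blaschke_den_neq0 alpha z : (forall i, `|alpha i| < 1) -> `|z| <= 1 ->
  (blaschke_den alpha).[z] != 0.
Proof.
move=> a1 z1; rewrite horner_blaschke_den; apply/prodf_neq0 => i _.
rewrite subr_eq0; apply/eqP => /(congr1 Num.norm); rewrite normr1 normrM norm_conjC.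
move=> E; have := ler_pM (normr_ge0 _) (normr_ge0 _) (lexx `|alpha i|) z1.
by rewrite -E mulr1 => /le_lt_trans/(_ (a1 i)); rewrite ltxx.
Qed.

Lemma blaschke_num_circle alpha z : `|z| = 1 ->
  (blaschke_num alpha).[z] = z ^+ n * ((blaschke_den alpha).[z])^*.
Proof.
move=> z1; rewrite horner_blaschke_num horner_blaschke_den rmorph_prod /=.
rewrite -[X in z ^+ X]card_ord -prodr_const -big_split /=; apply: eq_bigr => i _.
rewrite rmorphB rmorph1 rmorphM /= conjCK (norm1_conjC z1) mulrBr mulr1 mulrCA.
by rewrite mulfV ?mulr1 // norm1_neq0.
Qed.

Lemma blaschke_factor_le (w z : C) : `|w| < 1 -> `|z| <= 1 ->
  `|z - w| <= `|1 - w^* * z|.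
Proof.
move=> w1 z1; rewrite -(@ler_pXn2r _ 2) ?nnegrE // !normCK -subr_ge0.
have -> : (1 - w^* * z) * (1 - w^* * z)^* - (z - w) * (z - w)^* =
          (1 - `|z| ^+ 2) * (1 - `|w| ^+ 2).
  by rewrite !normCK !rmorphB rmorph1 rmorphM /= conjCK; ring.
by rewrite mulr_ge0 // subr_ge0 expr_le1 // ltW.
Qed.

Lemma blaschke_num_le_den alpha z : (forall i, `|alpha i| < 1) -> `|z| <= 1 ->
  `|(blaschke_num alpha).[z]| <= `|(blaschke_den alpha).[z]|.
Proof.
move=> a1 z1; rewrite horner_blaschke_num horner_blaschke_den !normr_prod.
by apply: ler_prod => i _; rewrite normr_ge0 blaschke_factor_le.
Qed.

(** The zeros of the numerator lie in the disc, where the denominator does not vanish. *)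
Lemma coprimep_blaschke alpha : (forall i, `|alpha i| < 1) ->
  coprimep (blaschke_num alpha) (blaschke_den alpha).
Proof.
move=> a1; rewrite coprimep_sym; apply: (big_ind (coprimep (blaschke_den alpha))).
- exact: coprimep1.
- by move=> p q cp cq; rewrite coprimepMr cp.
- by move=> i _; rewrite coprimep_XsubC rootE blaschke_den_neq0 // ltW.
Qed.

(** Cross-multiplication gives an identity on the circle off [s], hence between polynomials. By
    coprimality the Blaschke numerator divides [p], and the degree bound on [p] leaves a constant
    cofactor. *)
Lemma blaschke_quotient alpha gamma p q (s : seq C) :
  `|gamma| = 1 -> (forall i, `|alpha i| < 1) -> (size p <= n.+1)%N ->
  (forall z, `|z| <= 1 -> z \notin s -> q.[z] != 0 /\
     gamma * \prod_(i < n) ((z - alpha i) / (1 - (alpha i)^* * z)) =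
     p.[z] / q.[z]) ->
  exists m, [/\ m != 0, p = (m * gamma) *: blaschke_num alpha
              & q = m *: blaschke_den alpha].
Proof.
move=> g1 a1 szp pq; have g0 := norm1_neq0 g1.
have E : p * blaschke_den alpha = gamma *: blaschke_num alpha * q.
  apply: (@poly_circle_eq _ s) => z z1 zs.
  have [q0] := pq z (norm1_le1 z1) zs.
  rewrite !hornerE prodf_div -horner_blaschke_num -horner_blaschke_den => E.
  have d0 := blaschke_den_neq0 a1 (norm1_le1 z1).
  by apply/eqP; rewrite -eqr_div // -E mulrA.
have p0 : p != 0.
  apply/eqP => p0; move: E; rewrite p0 mul0r => /esym/eqP.
  rewrite -scalerAl scaler_eq0 mulf_eq0 (negPf g0) (negPf (blaschke_num_neq0 _)) /=.
  move=> /eqP q0; have [z [z1 zs]] := circle_avoid s.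
  by have [] := pq z (norm1_le1 z1) zs; rewrite q0 horner0 eqxx.
have : blaschke_num alpha %| p.
  rewrite -(@Gauss_dvdpl _ _ (blaschke_den alpha)) ?coprimep_blaschke //.
  by rewrite E -scalerAl dvdpZr // dvdp_mulr.
case/dvdpP => r Er.
have r0 : r != 0 by apply: contraNneq p0 => r0; rewrite Er r0 mul0r.
have : (size r <= 1)%N.
  move: szp; rewrite Er size_mul ?blaschke_num_neq0 // size_blaschke_num.
  by rewrite addnS /= -[n.+1]add1n leq_add2r.
move/size1_polyC => rc; set m := r`_0 in rc.
have m0 : m != 0 by rewrite -polyC_eq0 -rc.
exists (m / gamma); split.
- by rewrite mulf_neq0 ?invr_eq0.
- by rewrite divfK // Er rc mul_polyC.
- move: E; rewrite Er rc mul_polyC -!scalerAl [RHS]scalerAr.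
  rewrite [LHS]scalerAr => /(mulfI (blaschke_num_neq0 _)).
  by rewrite mulrC => E; rewrite -scalerA E scalerA mulVf // scale1r.
Qed.

End BlaschkeQuotient.

(** * Linear fractional maps and pencils of inner functions *)

Section LinearFractional.
Variable C : numClosedFieldType.
Implicit Types a b c d z : C.

Lemma linear_neq0 c d z : `|c| <= `|d| -> d != 0 -> `|z| < 1 -> c * z + d != 0.
Proof.
move=> cd d0 z1; rewrite addr_eq0; apply/eqP => /(congr1 Num.norm).
rewrite normrN normrM; have [->|c0] := eqVneq c 0.
  by rewrite normr0 mul0r => /esym/eqP; rewrite normr_eq0 (negPf d0).
move=> E; have : `|c| * `|z| < `|c| by rewrite gtr_pMr ?normr_gt0.
by rewrite E => /lt_le_trans/(_ cd); rewrite ltxx.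
Qed.

Lemma norm_linear_max a b :
  exists w, `|w| = 1 /\ `|a * w + b| = `|a| + `|b|.
Proof.
have [->|a0] := eqVneq a 0.
  by exists 1; rewrite normr1 mul0r normr0 !add0r.
have [->|b0] := eqVneq b 0.
  by exists 1; rewrite normr1 mulr1 normr0 !addr0.
have na0 : `|a| != 0 by rewrite normr_eq0.
have nb0 : `|b| != 0 by rewrite normr_eq0.
(* This rotation gives a w the argument of b, the equality case of the triangle inequality. *)
exists (b / `|b| * (`|a| / a)); split.
  by rewrite !(normrM, normfV) !normr_id !mulfV // mulr1.
have -> : a * (b / `|b| * (`|a| / a)) + b = b / `|b| * (`|a| + `|b|) by field;
  rewrite ?nb0 ?a0.
by rewrite !(normrM, normfV) normr_id mulfV // mul1r ger0_norm // addr_ge0.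
Qed.

(* Precomposing with the disc automorphism taking the pole of the map to
   infinity makes the map affine, where the bound is a triangle inequality. *)
Lemma linear_fractional_le a b c d : `|c| < `|d| ->
  (forall z, `|z| = 1 -> `|a * z + b| <= `|c * z + d|) ->
  forall z, `|z| <= 1 -> `|a * z + b| <= `|c * z + d|.
Proof.
move=> cd circ.
pose h := `|d| ^+ 2 - `|c| ^+ 2; pose A := a * d - b * c.
pose B := b * d^* - a * c^*.
have h0 : 0 < h by rewrite subr_gt0 ltr_pXn2r ?nnegrE.
have hE : h = d * d^* - c * c^* by rewrite /h !normCK.
have split z : h * (a * z + b) = A * (d^* * z + c^*) + B * (c * z + d).
  by rewrite hE /A /B; ring.
have AB : `|A| + `|B| <= h.
  have [w [w1 wE]] := norm_linear_max A B.
  have ww : w * w^* = 1 by rewrite -normCK w1 expr1n.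
  have n0 : d^* - w * c != 0.
    rewrite subr_eq0; apply/eqP => /(congr1 Num.norm).
    by rewrite normrM w1 mul1r norm_conjC => E; rewrite E ltxx in cd.
  pose z := (w * d - c^*) / (d^* - w * c).
  have z1 : `|z| = 1.
    have -> : `|z| = `|w * (d^* - w * c)^* | / `|d^* - w * c|.
      rewrite /z normf_div; congr (`|_| / _).
      by rewrite rmorphB rmorphM /= conjCK mulrBr mulrA ww mul1r.
    by rewrite normrM w1 mul1r norm_conjC mulfV // normr_eq0.
  have uE : d^* * z + c^* = w * (c * z + d) by rewrite /z; field.
  have v0 : 0 < `|c * z + d|.
    rewrite normr_gt0 addr_eq0; apply/eqP => /(congr1 Num.norm).
    by rewrite normrN normrM z1 mulr1 => E; rewrite E ltxx in cd.
  have := split z; rewrite uE (mulrA A) -mulrDl => /(congr1 Num.norm).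
  rewrite !normrM wE (gtr0_norm h0) => E.
  by rewrite -(ler_pM2r v0) -E ler_pM2l // circ.
move=> z z1; rewrite -(ler_pM2l h0) -{1}(gtr0_norm h0) -normrM split.
apply: (le_trans (ler_normD _ _)); rewrite !normrM.
have uv : `|d^* * z + c^*| <= `|c * z + d|.
  rewrite -(@ler_pXn2r _ 2) ?nnegrE // !normCK -subr_ge0.
  have -> : (c * z + d) * (c * z + d)^* - (d^* * z + c^*) * (d^* * z + c^*)^*
            = h * (1 - `|z| ^+ 2).
    by rewrite normCK hE !rmorphD !rmorphM /= !conjCK; ring.
  by rewrite mulr_ge0 ?(ltW h0) // subr_ge0 expr_le1.
apply: (@le_trans _ _ ((`|A| + `|B|) * `|c * z + d|)).
  by rewrite mulrDl lerD2r ler_wpM2l.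
by rewrite ler_wpM2r.
Qed.

(** If |c| < |d|, the bound on the circle propagates to the disc. If |c| = |d|, the denominator
    vanishes at a point of the circle, so the numerator does too and the map degenerates to the
    constant b / d. *)
Lemma linear_fractional_contract a b c d : `|c| <= `|d| -> d != 0 ->
  (forall z, `|z| = 1 -> `|a * z + b| <= `|c * z + d|) ->
  forall z w : C, `|z| < 1 -> `|w| < 1 -> c * z + d - w * (a * z + b) != 0.
Proof.
move=> cd d0 circ z w z1 w1; have v0 := linear_neq0 cd d0 z1.
have [ecd|ncd] := eqVneq `|c| `|d|.
  have c0 : c != 0 by rewrite -normr_eq0 ecd normr_eq0.
  have u1 : `|d / c| = 1 by rewrite normf_div ecd mulfV // normr_eq0.
  have := circ (- (d / c)); rewrite normrN => /(_ u1).
  have -> : c * - (d / c) + d = 0 by field.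
  rewrite normr0 normr_le0 => /eqP E.
  have {E} aE : a = b / d * c.
    by apply/eqP; rewrite -subr_eq0; apply/eqP; rewrite -[RHS](mulr0 (- (c / d))) -E;
      field; rewrite ?c0 ?d0.
  (* At the point opposite to the common zero, numerator and denominator are 2 b and 2 d, so |b| <=
     |d|. *)
  have := circ _ u1.
  have -> : a * (d / c) + b = 2 * b by rewrite aE; field; rewrite ?c0 ?d0.
  have -> : c * (d / c) + d = 2 * d by field.
  rewrite !normrM ler_pM2l ?normr_gt0 ?pnatr_eq0 // => bd.
  have -> : c * z + d - w * (a * z + b) = (1 - b / d * w) * (c * z + d).
    by rewrite aE; field.
  rewrite mulf_neq0 // addrC -mulNr linear_neq0 ?oner_eq0 //.
  by rewrite normrN normf_div normr1 ler_pdivrMr ?normr_gt0 // mul1r.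
have lt_cd : `|c| < `|d| by rewrite lt_neqAle ncd.
have le_z := linear_fractional_le lt_cd circ (ltW z1).
rewrite subr_eq0; apply/eqP => /(congr1 Num.norm); rewrite normrM => E.
have : `|w| * `|a * z + b| <= `|w| * `|c * z + d| by rewrite ler_wpM2l.
by rewrite -E ler_pMl ?normr_gt0 // => /(lt_le_trans w1); rewrite ltxx.
Qed.

End LinearFractional.

(** * Affine functions of a parameter on the circle *)

Section Affine.
Variable C : numClosedFieldType.
Implicit Types a b c d e f z : C.

Lemma affine_inj a b e f z w : z != w ->
  a * z + b = e * z + f -> a * w + b = e * w + f -> a = e /\ b = f.
Proof.
move=> zw Ez Ew; have ae : a = e.
  have : (a - e) * (z - w) = (a * z + b) - (a * w + b) - ((e * z + f) - (e * w + f))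
    by ring.
  rewrite Ez Ew subrr => /eqP; rewrite mulf_eq0 !subr_eq0 (negPf zw) orbF.
  by move/eqP.
by split=> //; move: Ez; rewrite ae => /addrI.
Qed.

Lemma affine_circle_inj (s : seq C) a b e f :
  (forall z, `|z| = 1 -> z \notin s -> a * z + b = e * z + f) ->
  a = e /\ b = f.
Proof.
move=> ab; have [z [z1 zs]] := circle_avoid s.
have [w [w1]] := circle_avoid (z :: s); rewrite inE negb_or => /andP[wz ws].
by apply: (affine_inj wz); [exact: ab w1 ws | exact: ab z1 zs].
Qed.

(** A non-strict inequality passes to the finitely many excluded points by continuity, made
    quantitative with the Lipschitz constants |a| and |c|. *)
Lemma affine_le_closure (s : seq C) a b c d :
  (forall z, `|z| = 1 -> z \notin s -> `|a * z + b| <= `|c * z + d|) ->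
  forall z, `|z| = 1 -> `|a * z + b| <= `|c * z + d|.
Proof.
move=> ab z z1; rewrite real_leNgt ?normr_real //; apply/negP => lt_z.
have k0 : 0 < `|a| + `|c| + 1 by rewrite ltr_wpDl // addr_ge0.
have e0 : 0 < (`|a * z + b| - `|c * z + d|) / (`|a| + `|c| + 1).
  by rewrite divr_gt0 // subr_gt0.
have [w [w1 wz ws]] := circle_avoid_near s z1 e0.
have {}ab := ab w w1 ws; rewrite ltr_pdivlMr // in wz.
have A : `|a * z + b| <= `|a * w + b| + `|a| * `|w - z|.
  have -> : a * z + b = a * w + b - a * (w - z) by ring.
  by rewrite -normrM ler_normB.
have D : `|c * w + d| <= `|c * z + d| + `|c| * `|w - z|.
  have -> : c * w + d = c * z + d + c * (w - z) by ring.
  by rewrite -normrM ler_normD.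
have A' : `|a * z + b| - `|c * z + d| <= `|w - z| * (`|a| + `|c|).
  rewrite lerBlDr (le_trans A) //.
  have -> : `|w - z| * (`|a| + `|c|) + `|c * z + d| =
            `|c * z + d| + `|c| * `|w - z| + `|a| * `|w - z| by ring.
  by rewrite lerD2r (le_trans ab).
have := lt_le_trans wz A'; rewrite mulrDr mulr1 gtrDl => /lt_geF.
by rewrite normr_ge0.
Qed.

End Affine.

(** * Normalized pencils of inner functions *)

Section Pencil.
Variables (C : numClosedFieldType) (n : nat).
Implicit Types (p q : {poly C}) (z : C).

(** A division-free form of the statement that p / q is inner: the last clause makes [p] a
    unimodular multiple of the reflection of [q] of order [n]. *)
Definition inner_pair p q : Prop :=
  [/\ forall z, `|z| <= 1 -> q.[z] != 0,
      forall z, `|z| <= 1 -> `|p.[z]| <= `|q.[z]|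
    & exists2 u, `|u| = 1 &
        forall z, `|z| = 1 -> p.[z] = u * z ^+ n * (q.[z])^*].

Lemma blaschke_inner_pair (alpha : 'I_n -> C) (gamma m : C) p q :
  `|gamma| = 1 -> (forall i, `|alpha i| < 1) -> m != 0 ->
  p = (m * gamma) *: blaschke_num alpha -> q = m *: blaschke_den alpha ->
  inner_pair p q.
Proof.
move=> g1 a1 m0 -> ->; split.
- by move=> z z1; rewrite hornerZ mulf_neq0 // blaschke_den_neq0.
- move=> z z1; rewrite !hornerZ !normrM g1 mulr1 ler_wpM2l //.
  exact: blaschke_num_le_den.
(* Reflecting the denominator conjugates the scalar [m], which this constant compensates. *)
- exists (m * gamma / m^*) => [|z z1].
    by rewrite normf_div norm_conjC normrM g1 mulr1 mulfV // normr_eq0.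
  rewrite !hornerZ (blaschke_num_circle _ z1) rmorphM /=.
  by field; rewrite conjC_eq0.
Qed.

Lemma inner_pair_circle p q z : inner_pair p q -> `|z| = 1 ->
  `|p.[z] / q.[z]| = 1.
Proof.
move=> [q0 _ [u u1 pq]] z1; rewrite pq // normf_div !normrM norm_conjC u1 normrX z1.
by rewrite expr1n !mul1r mulfV // normr_eq0 q0 ?z1.
Qed.

Variables (a b c d : {poly C}) (tau : C) (s : seq C).
Hypotheses (tau1 : `|tau| = 1).
Hypotheses (a1 : a.[tau] = 1) (b0 : b.[tau] = 0) (c0 : c.[tau] = 0)
  (d1 : d.[tau] = 1).
Hypothesis good : forall zeta, `|zeta| = 1 -> zeta \notin s ->
  inner_pair (zeta *: a + b) (zeta *: c + d).

(** The normalization at [tau] forces u = zeta / tau^n. As zeta zeta^* = 1, the reflection identity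
    becomes affine in zeta on both sides; it holds for infinitely many zeta, so coefficients
    agree. *)
Lemma pencil_circle z : `|z| = 1 ->
  a.[z] = (z / tau) ^+ n * (d.[z])^* /\ b.[z] = (z / tau) ^+ n * (c.[z])^*.
Proof.
move=> z1; apply: (@affine_circle_inj _ s) => zeta zeta1 zs.
have [_ _ [u _ E]] := good zeta1 zs.
have tn0 : tau ^+ n != 0 by rewrite expf_neq0 // norm1_neq0.
have uE : u = zeta / tau ^+ n.
  move: (E tau tau1); rewrite !hornerE a1 b0 c0 d1 mulr1 addr0 mulr0 add0r.
  by rewrite rmorph1 mulr1 => ->; field.
have zz : zeta * zeta^* = 1 by rewrite -normCK zeta1 expr1n.
move: (E z z1); rewrite !hornerE uE rmorphD rmorphM /= [zeta * a.[z]]mulrC => ->.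
transitivity (zeta * zeta^* * (z ^+ n / tau ^+ n) * (c.[z])^*
  + zeta * (z ^+ n / tau ^+ n) * (d.[z])^*); first by field.
by rewrite zz expr_div_n; field.
Qed.

Lemma pencil_le z zeta : `|z| <= 1 -> `|zeta| = 1 ->
  `|a.[z] * zeta + b.[z]| <= `|c.[z] * zeta + d.[z]|.
Proof.
move=> z1; apply: (@affine_le_closure _ s) => {}zeta zeta1 zs.
have [_ + _] := good zeta1 zs; move/(_ z z1).
by rewrite !hornerE ![zeta * _]mulrC.
Qed.

(** Its zeros contain every point of the closed disc where |c| = |d|; a single nonzero polynomial
    thus witnesses that this set is finite. *)
Definition pencil_exceptional : {poly C} :=
  \prod_(zeta <- s) (zeta *: c + d).

Lemma pencil_exceptional_neq0 : pencil_exceptional != 0.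
Proof.
rewrite prodf_seq_neq0; apply/allP => zeta _; apply/eqP => /(congr1 (horner^~ tau)).
by rewrite !hornerE c0 d1 mulr0 add0r => /eqP; rewrite oner_eq0.
Qed.

(** If both values were 0, the denominator would vanish at [z] for every zeta, contrary to goodness
    off [s]. Otherwise - d / c is a unimodular zeta killing the denominator, so it belongs to
    [s]. *)
Lemma pencil_zero z : `|z| <= 1 -> `|c.[z]| = `|d.[z]| ->
  d.[z] != 0 /\ pencil_exceptional.[z] = 0.
Proof.
move=> z1 cd; have zero zeta : `|zeta| = 1 -> c.[z] * zeta + d.[z] = 0 -> zeta \in s.
  move=> zeta1 E; apply: contraT => zs; have [/(_ z z1) + _ _] := good zeta1 zs.
  by rewrite !hornerE mulrC E eqxx.
have d0 : d.[z] != 0.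
  apply/eqP => d0; move/eqP: cd; rewrite d0 normr0 normr_eq0 => /eqP cz0.
  have [zeta [zeta1 /negP[]]] := circle_avoid s.
  by apply: zero => //; rewrite cz0 d0 mul0r addr0.
split=> //; have cz0 : c.[z] != 0 by rewrite -normr_eq0 cd normr_eq0.
have E : c.[z] * - (d.[z] / c.[z]) + d.[z] = 0 by field.
have : - (d.[z] / c.[z]) \in s.
  by apply: zero => //; rewrite normrN normf_div cd mulfV // normr_eq0.
move=> zs; rewrite /pencil_exceptional horner_prod; apply/eqP; rewrite prodf_seq_eq0;
  apply/hasP.
by exists (- (d.[z] / c.[z])) => //; rewrite !hornerE mulrC E.
Qed.

End Pencil.

(** * Factorization of the determinant of a pencil *)

Section SelfReflective.
Variable R : realType.
Implicit Types (p : {poly R[i]}) (z w : R[i]).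

Lemma horner_reflection m p z : (size p <= m.+1)%N -> `|z| = 1 ->
  (reflection m p).[z] = z ^+ m * (p.[z])^*.
Proof.
move=> szp z1; rewrite horner_poly (horner_coef_wide z szp) rmorph_sum mulr_sumr /=.
rewrite (reindex_inj rev_ord_inj) /=; apply: eq_bigr => i _.
have im : (i <= m)%N by rewrite -ltnS.
rewrite subSS subKn // rmorphM rmorphXn /= (norm1_conjC z1) mulrCA; congr (_ * _).
have -> : z ^+ m = z ^+ (m - i) * z ^+ i by rewrite -exprD subnK.
by rewrite -mulrA exprVn mulfV ?mulr1 // expf_neq0 // norm1_neq0.
Qed.

Lemma size_reflection m p : (size (reflection m p) <= m.+1)%N.
Proof. exact: size_poly. Qed.

Lemma subr_conjM_eq0 w z : `|w| <= 1 -> `|z| <= 1 ->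
  1 - w^* * z = 0 -> w = z /\ `|z| = 1.
Proof.
move=> w1 z1 /eqP; rewrite subr_eq0 => /eqP E.
have N : `|w| * `|z| = 1 by rewrite -norm_conjC -normrM -E normr1.
have ez : `|z| = 1.
  apply: le_anti; rewrite z1 /= -N.
  by rewrite ler_piMl.
have ew : `|w| = 1 by rewrite -N ez mulr1.
split=> //; move/eqP: E; rewrite (norm1_conjC ew) mulrC eq_sym.
by rewrite -[X in _ == X -> _](mulfV (norm1_neq0 ew)) => /eqP/mulIf -> //;
  rewrite invr_eq0 norm1_neq0.
Qed.

Variables (n k : nat) (sigma : 'I_n -> R[i]).
Hypotheses (sigma_inj : injective sigma) (sigma_cd : in_circle_disc k sigma).

Lemma node_le1 j : `|sigma j| <= 1.
Proof. by move: (sigma_cd j); case: ifP => _; [move-> | move/ltW]. Qed.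

Lemma node_circleE j : (`|sigma j| == 1) = (j < k)%N.
Proof.
by move: (sigma_cd j); case: ifP => _; [move->; rewrite eqxx | move=> /lt_eqF].
Qed.

Lemma blaschke_num_roots : blaschke_num sigma = \prod_(z <- codom sigma) ('X - z%:P).
Proof. by rewrite big_map enumT. Qed.

Lemma blaschke_num_dvd p : (forall j, root p (sigma j)) -> blaschke_num sigma %| p.
Proof.
move=> rp; rewrite blaschke_num_roots; apply: uniq_roots_dvdp.
  by apply/allP => z /codomP[j ->].
by rewrite uniq_rootsE map_inj_uniq ?enum_uniq.
Qed.

Lemma blaschke_num_node j : (blaschke_num sigma).[sigma j] = 0.
Proof.
by rewrite horner_blaschke_num; apply/eqP/prodf_eq0; exists j; rewrite ?subrr.
Qed.

Lemma deriv_blaschke_num_node j : (blaschke_num sigma)^`().[sigma j] != 0.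
Proof.
rewrite /blaschke_num (bigD1 j) //= derivM derivXsubC mul1r !hornerE subrr mul0r addr0.
rewrite horner_prod; apply/prodf_neq0 => i ij; rewrite !hornerE subr_eq0.
by apply: contraNneq ij => /sigma_inj ->.
Qed.

Lemma blaschke_den_root z : `|z| <= 1 -> (blaschke_den sigma).[z] = 0 ->
  exists2 j, z = sigma j & `|z| = 1.
Proof.
move=> z1; rewrite horner_blaschke_den => /eqP/prodf_eq0[j _ /eqP].
by case/(subr_conjM_eq0 (node_le1 j) z1) => <-; exists j.
Qed.

(* Writing [W = B * A] with [A] the product over the nodes, the symmetry of [W]
   forces the reflection of [B] to vanish at all nodes, so that it is a scalar
   multiple of [A]. *)
Lemma self_reflective_factor (W : {poly R[i]}) (tau : R[i]) :
  (size W <= n + n.+1)%N -> `|tau| = 1 ->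
  (forall z, `|z| = 1 -> W.[z] = (z / tau) ^+ (n + n) * (W.[z])^*) ->
  (forall j, W.[sigma j] = 0) ->
  (forall j : 'I_n, (j < k)%N -> W^`().[sigma j] = 0) ->
  exists C, W = C *: (blaschke_num sigma * blaschke_den sigma).
Proof.
move=> szW tau1 Wsym W0 dW0.
have /dvdpP[B WE] : blaschke_num sigma %| W.
  by apply: blaschke_num_dvd => j; rewrite rootE W0 eqxx.
have szB : (size B <= n.+1)%N.
  have [->|B0] := eqVneq B 0; first by rewrite size_poly0.
  move: szW; rewrite WE size_mul ?blaschke_num_neq0 // size_blaschke_num.
  by rewrite addnS /= addnC leq_add2l.
pose B' := reflection n B.
(* The symmetry of [W] reflects each factor of B A, and the reflection of the numerator [A] is the
   denominator. *)
have E : W = (tau ^- (n + n)) *: (B' * blaschke_den sigma).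
  apply: (@poly_circle_eq _ [::]) => z z1 _.
  rewrite (Wsym z z1) {1}WE !hornerE horner_reflection //.
  rewrite (blaschke_num_circle sigma z1) !rmorphM rmorphXn /= conjCK.
  rewrite (norm1_conjC z1) exprVn expr_div_n !exprD.
  by field; rewrite !expf_neq0 ?norm1_neq0.
(* At a circle node the double zero of [W] makes [B], hence its reflection, vanish. At a disc node
   the denominator is nonzero, so the zero of [W] falls on [B']. *)
have B'0 j : B'.[sigma j] = 0.
  move: (sigma_cd j); case: ifP => [jk s1|jk s1].
    rewrite horner_reflection //; apply/eqP; rewrite mulf_eq0 conjC_eq0.
    move: (dW0 j jk); rewrite WE derivM !hornerE blaschke_num_node mulr0 add0r.
    move=> /eqP; rewrite mulf_eq0 (negPf (deriv_blaschke_num_node j)) orbF => ->.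
    by rewrite orbT.
  have /eqP := W0 j; rewrite E !hornerE !mulf_eq0 invr_eq0.
  rewrite (negPf (expf_neq0 _ (norm1_neq0 tau1))) /= => /orP[/eqP //|/eqP].
  by case/(blaschke_den_root (ltW s1)) => _ _ s1'; rewrite s1' ltxx in s1.
have /dvdpP[r B'E] : blaschke_num sigma %| B'.
  by apply: blaschke_num_dvd => j; rewrite rootE B'0 eqxx.
have [C rE] : exists C, r = C%:P.
  exists r`_0; apply: size1_polyC.
  have [->|r0] := eqVneq r 0; first by rewrite size_poly0.
  move: (size_reflection n B); rewrite -/B' B'E size_mul ?blaschke_num_neq0 //.
  by rewrite size_blaschke_num addnS /= -[n.+1]add1n leq_add2r.
(* Reflecting [B'], which is C times the numerator, returns [B] as C^* times the denominator. *)
exists C^*; rewrite WE mulrC scalerAr; congr (_ * _).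
apply: (@poly_circle_eq _ [::]) => z z1 _.
have : z ^+ n * (B'.[z])^* = B.[z].
  rewrite horner_reflection // rmorphM rmorphXn /= conjCK (norm1_conjC z1) exprVn.
  by rewrite mulrA mulfV ?mul1r // expf_neq0 // norm1_neq0.
move=> <-; rewrite B'E rE mul_polyC !hornerE (blaschke_num_circle sigma z1).
rewrite !rmorphM rmorphXn /= conjCK (norm1_conjC z1) exprVn.
by field; rewrite expf_neq0 // norm1_neq0.
Qed.

(** A circle node is also a simple zero of the denominator, since there 1 - s^* z = - s^* (z -
    s). *)
Lemma mup_blaschke_nodes j : mup (sigma j) (blaschke_num sigma * blaschke_den sigma) =
  if `|sigma j| < 1 then 1%N else 2.
Proof.
have mup_num : mup (sigma j) (blaschke_num sigma) = 1%N.
  rewrite blaschke_num_roots mu_prod_XsubC count_uniq_mem ?codom_f //.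
  by rewrite map_inj_uniq ?enum_uniq.
have [s1|s1] := boolP (`|sigma j| < 1).
  rewrite mupMl // rootE; apply/eqP.
  by case/(blaschke_den_root (ltW s1)) => _ _ s1'; rewrite s1' ltxx in s1.
have {}s1 : `|sigma j| = 1.
  by apply/eqP; rewrite -[_ == _]negbK; apply: contra s1 => s1;
    rewrite lt_neqAle s1 node_le1.
have den0 : blaschke_den sigma != 0.
  apply/eqP => /(congr1 (horner^~ 0)); rewrite horner0 horner_blaschke_den.
  by under eq_bigr do rewrite mulr0 subr0; rewrite big1_eq => /eqP; rewrite oner_eq0.
rewrite mupM ?blaschke_num_neq0 // mup_num; congr (1 + _)%N.
rewrite /blaschke_den (bigD1 j) //= mupMl; last first.
  rewrite rootE horner_prod; apply/prodf_neq0 => i ij; rewrite !hornerE.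
  apply: contraNneq ij => /(subr_conjM_eq0 (node_le1 i) (node_le1 j))[].
  by move=> /sigma_inj ->.
have -> : 1 - (sigma j)^* *: 'X = (- (sigma j)^*)%:P * ('X - (sigma j)%:P).
  have ss : ((sigma j)^*)%:P * (sigma j)%:P = 1 :> {poly R[i]}.
    by rewrite -polyCM (norm1_conjC s1) mulVf ?norm1_neq0.
  by rewrite polyCN -mul_polyC -[X in X - _]ss; ring.
rewrite mupMr ?(mup_XsubCX 1) ?eqxx // rootC oppr_eq0 conjC_eq0.
exact: norm1_neq0.
Qed.

Lemma blaschke_nodes_root z : `|z| <= 1 ->
  (blaschke_num sigma * blaschke_den sigma).[z] = 0 -> exists j, z = sigma j.
Proof.
move=> z1 /eqP; rewrite hornerM mulf_eq0 => /orP[/eqP|/eqP]; last first.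
  by case/(blaschke_den_root z1) => j; exists j.
rewrite horner_blaschke_num => /eqP/prodf_eq0[j _].
by rewrite subr_eq0 => /eqP ->; exists j.
Qed.

End SelfReflective.

(** * Phasar derivatives *)

Section ComplexDerivative.
Variable R : realType.
Implicit Types (F G : R -> R[i]) (t : R) (l : R[i]).

(** Differentiation with respect to a real variable is done on real and imaginary parts, so the
    rules for real functions apply. *)
Definition is_cderive F t l : Prop :=
  is_derive t (1 : R) (fun x => complex.Re (F x)) (complex.Re l) /\
  is_derive t (1 : R) (fun x => complex.Im (F x)) (complex.Im l).

Lemma complexReM (z w : R[i]) : complex.Re (z * w) =
  complex.Re z * complex.Re w - complex.Im z * complex.Im w.
Proof. by case: z w => ? ? []. Qed.

Lemma complexImM (z w : R[i]) : complex.Im (z * w) =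
  complex.Re z * complex.Im w + complex.Im z * complex.Re w.
Proof. by case: z w => ? ? []. Qed.

Lemma complexReD (z w : R[i]) : complex.Re (z + w) = complex.Re z + complex.Re w.
Proof. by case: z w => ? ? []. Qed.

Lemma complexImD (z w : R[i]) : complex.Im (z + w) = complex.Im z + complex.Im w.
Proof. by case: z w => ? ? []. Qed.

Lemma complexReC (z : R[i]) : complex.Re z^* = complex.Re z.
Proof. by case: z. Qed.

Lemma complexImC (z : R[i]) : complex.Im z^* = - complex.Im z.
Proof. by case: z. Qed.

Lemma is_cderive_cst l t : is_cderive (fun=> l) t 0.
Proof. by split; apply: is_derive_cst. Qed.

Lemma is_cderiveD F G t l m : is_cderive F t l -> is_cderive G t m ->
  is_cderive (fun x => F x + G x) t (l + m).
Proof.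
move=> [Fr Fi] [Gr Gi]; split.
  under eq_fun do rewrite complexReD. rewrite complexReD; exact: is_deriveD.
under eq_fun do rewrite complexImD. rewrite complexImD; exact: is_deriveD.
Qed.

Lemma is_cderiveM F G t l m : is_cderive F t l -> is_cderive G t m ->
  is_cderive (fun x => F x * G x) t (l * G t + F t * m).
Proof.
move=> [Fr Fi] [Gr Gi]; split.
  under eq_fun do rewrite complexReM.
  apply: (@is_derive_eq _ _ _ _ _ _ _ _ (is_deriveB (is_deriveM Fr Gr) (is_deriveM Fi
    Gi))).
  by rewrite complexReD !complexReM /GRing.scale /=; ring.
under eq_fun do rewrite complexImM.
apply: (@is_derive_eq _ _ _ _ _ _ _ _ (is_deriveD (is_deriveM Fr Gi) (is_deriveM Fi
  Gr))).
by rewrite complexImD !complexImM /GRing.scale /=; ring.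
Qed.

Lemma is_cderive_conj F t l : is_cderive F t l ->
  is_cderive (fun x => (F x)^*) t l^*.
Proof.
move=> [Fr Fi]; split.
  by under eq_fun do rewrite complexReC; rewrite complexReC.
by under eq_fun do rewrite complexImC; rewrite complexImC; apply: is_deriveN.
Qed.

Lemma is_cderive_real t : is_cderive (fun x => (x%:C)%C) t 1.
Proof. by split => /=; [exact: is_derive_id | exact: is_derive_cst]. Qed.

Lemma is_cderive_horner (p : {poly R[i]}) F t l : is_cderive F t l ->
  is_cderive (fun x => p.[F x]) t (p^`().[F t] * l).
Proof.
move=> dF; elim/poly_ind: p => [|p c IH].
  under eq_fun do rewrite horner0.
  by rewrite deriv0 horner0 mul0r; apply: is_cderive_cst.
under eq_fun do rewrite hornerMXaddC.
have := is_cderiveD (is_cderiveM IH dF) (is_cderive_cst c t).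
congr (is_cderive _ _ _); rewrite derivMXaddC !hornerE; ring.
Qed.

Lemma is_cderive_cis (g : R -> R) t r : is_derive t (1 : R) g r ->
  is_cderive (fun x => cis (g x)) t ('i%C * (r%:C)%C * cis (g t)).
Proof.
move=> dg; split; rewrite !(complexReM, complexImM) /=.
  have := @is_derive1_comp _ (@cos R) g t _ _ (is_derive_cos _) dg.
  by move=> H; apply: (@is_derive_eq _ _ _ _ _ _ _ _ H); ring.
have := @is_derive1_comp _ (@sin R) g t _ _ (is_derive_sin _) dg.
by move=> H; apply: (@is_derive_eq _ _ _ _ _ _ _ _ H); ring.
Qed.

Lemma is_cderive_unique F G t l m : (\forall x \near t, F x = G x) ->
  is_cderive F t l -> is_cderive G t m -> l = m.
Proof.
move=> FG [Fr Fi] [Gr Gi]; apply/eqP; rewrite eq_complex; apply/andP; split; apply/eqP.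
  rewrite -(@derive_val _ _ _ _ _ _ _ Gr).
  have H : is_derive t (1 : R) (fun x => complex.Re (G x)) (complex.Re l).
    apply: near_eq_is_derive Fr.
    by near=> x; rewrite (near FG x).
  by rewrite (@derive_val _ _ _ _ _ _ _ H).
rewrite -(@derive_val _ _ _ _ _ _ _ Gi).
have H : is_derive t (1 : R) (fun x => complex.Im (G x)) (complex.Im l).
  apply: near_eq_is_derive Fi.
  by near=> x; rewrite (near FG x).
by rewrite (@derive_val _ _ _ _ _ _ _ H).
Unshelve. all: by end_near. Qed.

Lemma is_derive_continuous (f : R -> R) t r : is_derive t (1 : R) f r ->
  {for t, continuous f}.
Proof. by move=> [df _]; apply/differentiable_continuous/derivable1_diffP. Qed.

End ComplexDerivative.

(** * The circle parametrization and polar form *)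

Section Cis.
Variable R : realType.
Implicit Types (t : R) (z : R[i]).

Lemma cisD t u : cis (t + u) = cis t * cis u :> R[i].
Proof.
apply/eqP; rewrite eq_complex complexReM complexImM /=; apply/andP; split; apply/eqP.
  by rewrite cosD.
by rewrite sinD; ring.
Qed.

Lemma norm_cis t : `|cis t| = 1 :> R[i].
Proof. by rewrite normc_def /= cos2Dsin2 sqrtr1. Qed.

Lemma cis0 : cis 0 = 1 :> R[i].
Proof. by rewrite /cis cos0 sin0. Qed.

Lemma norm_realC t : 0 <= t -> `|(t%:C)%C : R[i]| = (t%:C)%C.
Proof. by move=> t0; rewrite ger0_norm // ler0c. Qed.

Lemma cis_surj z : `|z| = 1 -> exists t, cis t = z.
Proof.
case: z => x y z1; have : (x ^+ 2 + y ^+ 2)%:C%C = 1 :> R[i].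
  by rewrite (add_Re2_Im2 (x +i* y)%C) z1 expr1n.
move=> /complexI xy.
have x1 : -1 <= x <= 1 by have := sqr_ge0 y; nra.
have acx : cos (acos x) = x by apply: acosK; rewrite in_itv.
have sq : sin (acos x) = `|y|.
  rewrite sin_acos //; have -> : 1 - x ^+ 2 = y ^+ 2 by lra.
  exact: sqrtr_sqr.
have [y0|y0] := leP 0 y.
  by exists (acos x); rewrite /cis acx sq ger0_norm.
by exists (- acos x); rewrite /cis cosN sinN acx sq ltr0_norm // opprK.
Qed.

Lemma polar_of_cis (z : R[i]) t r : 0 < r -> cis t = (r%:C)%C * z -> z = `|z| * cis t.
Proof.
move=> r0 E; have := norm_cis t; rewrite E normrM (norm_realC (ltW r0)) => rz.
by rewrite mulrCA mulrA rz mul1r.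
Qed.

Lemma polar_atan z : 0 < complex.Re z ->
  z = `|z| * cis (atan (complex.Im z / complex.Re z)).
Proof.
move=> x0; set r := _ / _.
have c0 : 0 < cos (atan r).
  by rewrite cos_atan invr_gt0 sqrtr_gt0 ltr_pwDl // sqr_ge0.
have sE : sin (atan r) = r * cos (atan r).
  by rewrite -{2}[r]atanK /tan divfK ?gt_eqF.
apply: (@polar_of_cis _ _ (cos (atan r) / complex.Re z)); first by rewrite divr_gt0.
have xn0 : complex.Re z != 0 by rewrite gt_eqF.
apply/eqP; rewrite eq_complex complexReM complexImM /=; apply/andP; split; apply/eqP.
  by field.
by rewrite sE /r; field.
Qed.

End Cis.

(** * Phasar derivatives of quotients of polynomials *)

Section Phasar.
Variable R : realType.
Implicit Types (P Q : {poly R[i]}) (f : R[i] -> R[i]) (s : R[i]).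

Lemma is_cderive_circle P (t : R) :
  is_cderive (fun x => P.[cis x]) t ('i%C * cis t * P^`().[cis t]).
Proof.
have := is_cderive_horner P (is_cderive_cis (is_derive_id t (1 : R))).
congr (is_cderive _ _ _); rewrite /= mulr1; ring.
Qed.

(** Since |f| = 1 on the circle, P(e^{it}) = Q(e^{it}) e^{i g(t)} near [t0]; the two derivatives at
    [t0] are equal, and a factor i cancels. *)
Lemma phasar_quotient_deriv P Q f s (r : R) : phasar_derivative f s r ->
  (forall z, `|z| = 1 -> [/\ Q.[z] != 0, f z = P.[z] / Q.[z] & `|f z| = 1]) ->
  s * (P^`().[s] - f s * Q^`().[s]) = (r%:C)%C * f s * Q.[s].
Proof.
move=> [t0 [g [<- near_g dg]]] fPQ.
have f0 : f (cis t0) = cis (g t0).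
  have [_ {1}->] := nbhs_singleton near_g.
  by have [_ _ ->] := fPQ _ (norm_cis t0); rewrite mul1r.
have E : \forall t \near t0, P.[cis t] = Q.[cis t] * cis (g t).
  apply: filterS near_g => t [_]; have [Q0 fE f1] := fPQ _ (norm_cis t).
  by rewrite f1 mul1r fE => <-; rewrite mulrC divfK.
have := is_cderive_unique E (is_cderive_circle P t0)
  (is_cderiveM (is_cderive_circle Q t0) (is_cderive_cis dg)).
rewrite -f0 => {}E; apply: (mulfI (neq0Ci R[i])).
transitivity ('i%C * cis t0 * P^`().[cis t0] - 'i%C * cis t0 * Q^`().[cis t0] * f (cis
  t0)).
  by rewrite -[Num.imaginary]/('i%C : R[i]); ring.
by rewrite E -[Num.imaginary]/('i%C : R[i]); ring.
Qed.

(** The converse assumes |f| = 1 only at [s], because the first component of a tetra-inner map need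
    not be unimodular elsewhere on the circle. *)
Lemma quotient_phasar P Q f (s : R[i]) (r : R) : `|s| = 1 ->
  (forall z, `|z| = 1 -> Q.[z] != 0 /\ f z = P.[z] / Q.[z]) -> `|f s| = 1 ->
  s * (P^`().[s] - f s * Q^`().[s]) = (r%:C)%C * f s * Q.[s] ->
  phasar_derivative f s r.
Proof.
move=> s1 + +; have [t0 <-] := cis_surj s1 => {s s1} fPQ f1.
have [Q0 fs] := fPQ _ (norm_cis t0); have [th thE] := cis_surj f1.
set s := cis t0 in Q0 fs f1 thE *; move=> E.
(* [N] is f / f(s) times |Q|^2. It is positive at [t0], so near [t0] it stays in the right
   half-plane, where its argument is an arctangent. *)
pose N t := P.[cis t] * (f s * Q.[cis t])^*.
have dN := is_cderiveM (is_cderive_circle P t0)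
  (is_cderive_conj (is_cderiveM (is_cderive_cst (f s) t0) (is_cderive_circle Q t0))).
rewrite -/s in dN.
set l := (X in is_cderive _ _ X) in dN.
have PQ : P.[s] = f s * Q.[s] by rewrite fs divfK.
have ff : f s * (f s)^* = 1 by rewrite -normCK f1 expr1n.
(* The first two terms are conjugate, so the imaginary part comes from the last one alone and equals
   r |Q|^2. *)
have lE : l = 'i%C * s * Q^`().[s] * (Q.[s])^* + ('i%C * s * Q^`().[s] * (Q.[s])^*)^*
   + 'i%C * (r%:C)%C * (Q.[s] * (Q.[s])^*).
  have sP : 'i%C * s * P^`().[s] = 'i%C * (s * (f s * Q^`().[s]) + (r%:C)%C * f s *
    Q.[s]).
    by rewrite -E; ring.
  rewrite -[RHS]mul1r -ff /l sP PQ mul0r add0r !rmorphM /= conjCK; ring.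
have N0 : N t0 = Q.[s] * (Q.[s])^*.
  by rewrite /N -/s PQ rmorphM /= -[RHS]mul1r -ff; ring.
pose k := complex.Re (N t0).
have k0 : 0 < k.
  have : 0 < N t0 by rewrite N0 -normCK exprn_gt0 // normr_gt0.
  by rewrite ltcE => /andP[].
have NE : N t0 = (k%:C)%C.
  by rewrite /k RRe_real // N0 -normCK ger0_real // exprn_ge0.
have Il : complex.Im l = r * k.
  rewrite lE -N0 NE !complexImD complexImC addrN add0r.
  by rewrite -mulrA mulrC ImiRe -rmorphM.
exists t0, (fun t => th + atan (complex.Im (N t) / complex.Re (N t))).
have [dr di] := dN.
split=> //; last first.
  have kn0 : complex.Re (N t0) != 0 by rewrite gt_eqF.
  have := is_deriveM di (is_deriveV kn0 dr).
  move=> dq; have := is_deriveD (is_derive_cst th t0 (1 : R)) (is_derive1_comp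
    (is_derive1_atan _) dq).
  move=> H; apply: (@is_derive_eq _ _ _ _ _ _ _ _ H).
  (* As Im N vanishes at [t0], only Im l / k = r survives. *)
  change (0 + (1 + (complex.Im (N t0) * k^-1) ^+ 2)^-1 *
    (complex.Im (N t0) * (- k ^- 2 * complex.Re l) + k^-1 * complex.Im l) = r).
  have -> : complex.Im (N t0) = 0 by rewrite NE.
  by rewrite Il; field; rewrite gt_eqF.
have Npos : \forall t \near t0, 0 < complex.Re (N t).
  by have /(_ _ (lt_nbhsr k0)) := is_derive_continuous dr.
apply: filterS Npos => t Nt; have [Qt0 ft] := fPQ _ (norm_cis t).
have := polar_atan Nt; rewrite cisD thE; set e := cis (atan _) => NtE.
have q0 : Q.[cis t] * (Q.[cis t])^* != 0 by rewrite mulf_neq0 ?conjC_eq0.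
have fN : f (cis t) = N t * f s / (Q.[cis t] * (Q.[cis t])^*).
  rewrite ft /N rmorphM /= -{1}[P.[cis t] / _]mul1r -ff; field.
  by rewrite ?conjC_eq0 ?Qt0.
have nf : `|f (cis t)| = `|N t| / (Q.[cis t] * (Q.[cis t])^*).
  by rewrite fN normf_div normrM f1 mulr1 [X in _ / X]ger0_norm // -normCK exprn_ge0.
have Nt0 : N t != 0.
  by apply: contraTneq Nt => Nt0; rewrite [X in complex.Re X]Nt0 ltxx.
split; first by rewrite -normr_eq0 nf mulf_neq0 ?invr_eq0 ?normr_eq0.
by rewrite nf fN {1}NtE; ring.
Qed.

End Phasar.

(** * Curves in the closed disc *)

Section DiscPaths.
Variable R : realType.
Implicit Types (p : {poly R[i]}) (z w tau : R[i]) (x u : R).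

(* A quadratic Bezier curve from [z] to [tau]; when [w] is off the line through
   the end points, curves with different [u] only meet at the end points. *)
Definition bezier z w tau u : {poly R[i]} :=
  (1 - 'X) ^+ 2 * z%:P
  + 2%:P * 'X * (1 - 'X) * ((1 - (u%:C)%C) * z + (u%:C)%C * w)%:P
  + 'X ^+ 2 * tau%:P.

Lemma horner_bezier z w tau u x : (bezier z w tau u).[(x%:C)%C] =
  (((1 - x) ^+ 2)%:C)%C * z
  + ((2 * x * (1 - x))%:C)%C * (((1 - u)%:C)%C * z + (u%:C)%C * w)
  + ((x ^+ 2)%:C)%C * tau.
Proof.
rewrite /bezier !hornerE !(rmorphM, rmorphB, rmorphXn, rmorph1) /=.
by rewrite (rmorph_nat (real_complex R)).
Qed.

Lemma norm_realM x z : 0 <= x -> `|(x%:C)%C * z| = (x%:C)%C * `|z|.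
Proof. by move=> x0; rewrite normrM norm_realC. Qed.

Lemma bezier_le1 z w tau u x : `|z| <= 1 -> `|w| <= 1 -> `|tau| <= 1 ->
  0 <= u <= 1 -> 0 <= x <= 1 -> `|(bezier z w tau u).[(x%:C)%C]| <= 1.
Proof.
move=> z1 w1 tau1 /andP[u0 u1] /andP[x0 x1]; rewrite horner_bezier.
have le_real (y : R) v : 0 <= y -> `|v| <= 1 -> `|(y%:C)%C * v| <= (y%:C)%C.
  by move=> y0 v1; rewrite norm_realM // ler_piMr // ler0c.
have m1 : `|((1 - u)%:C)%C * z + (u%:C)%C * w| <= 1.
  apply: (le_trans (ler_normD _ _)).
  apply: (@le_trans _ _ (((1 - u)%:C)%C + (u%:C)%C)).
    by rewrite lerD // le_real // subr_ge0.
  by rewrite -rmorphD subrK.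
apply: (le_trans (ler_normD _ _)).
apply: (@le_trans _ _ ((((1 - x) ^+ 2)%:C)%C + ((2 * x * (1 - x))%:C)%C + ((x ^+
  2)%:C)%C)).
  rewrite lerD ?le_real ?sqr_ge0 //.
  apply: (le_trans (ler_normD _ _)); rewrite lerD ?le_real ?sqr_ge0 //.
  by rewrite !mulr_ge0 // subr_ge0.
rewrite -!rmorphD /=.
by have -> : (1 - x) ^+ 2 + 2 * x * (1 - x) + x ^+ 2 = 1 by ring.
Qed.

(** The hypothesis makes w - tau and z - tau independent over the reals, so both coordinates agree.
    Their sum is 1 - x^2, which determines x, and then the coordinate along w - tau determines u. *)
Lemma bezier_inj z w tau u v x y : complex.Im ((w - tau) * (z - tau)^*) != 0 ->
  0 < x < 1 -> 0 < y < 1 ->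
  (bezier z w tau u).[(x%:C)%C] = (bezier z w tau v).[(y%:C)%C] -> u = v.
Proof.
move=> delta0 /andP[x0 x1] /andP[y0 y1].
have zt0 : z - tau != 0.
  by apply: contraNneq delta0 => ->; rewrite conjC0 mulr0.
have E u' x' : (bezier z w tau u').[(x'%:C)%C] =
   tau + ((1 - x' ^+ 2 - 2 * x' * (1 - x') * u')%:C)%C * (z - tau)
       + ((2 * x' * (1 - x') * u')%:C)%C * (w - tau).
  rewrite horner_bezier !(rmorphM, rmorphB, rmorphXn, rmorph1) /=.
  by rewrite (rmorph_nat (real_complex R)); ring.
rewrite !E -!addrA => /addrI eqn.
have ImR (r : R) (q q' : R[i]) :
  complex.Im ((r%:C)%C * q * q') = r * complex.Im (q * q').
  by rewrite -mulrA complexImM /= mul0r addr0.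
have uv : 2 * x * (1 - x) * u = 2 * y * (1 - y) * v.
  have := congr1 (fun q => complex.Im (q * (z - tau)^*)) eqn.
  rewrite !mulrDl !complexImD !ImR.
  have -> : complex.Im ((z - tau) * (z - tau)^*) = 0.
    by rewrite -normCK ger0_Im // exprn_ge0.
  by rewrite !mulr0 !add0r => /(mulIf delta0).
move: eqn; rewrite uv => /addIr /(mulIf zt0) /complexI xy2.
have xy : x = y.
  apply/eqP; rewrite -(@eqrXn2 _ 2) ?ltW //; apply/eqP; lra.
subst y; apply: (@mulfI _ (2 * x * (1 - x))) => //.
by rewrite !mulf_neq0 ?pnatr_eq0 ?gt_eqF // subr_gt0.
Qed.

(** The origin serves unless it lies on the line through [z] and [tau]; in that case i tau is off
    the line. *)
Lemma exists_off_line z tau : `|tau| = 1 -> z != tau ->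
  exists2 w, `|w| <= 1 & complex.Im ((w - tau) * (z - tau)^*) != 0.
Proof.
move=> tau1 zt; pose q := tau * (z - tau)^*.
have q0 : q != 0.
  by rewrite mulf_neq0 ?conjC_eq0 ?subr_eq0 // norm1_neq0.
have [qi|qi] := eqVneq (complex.Im q) 0; last first.
  exists 0; rewrite ?normr0 // sub0r mulNr -/q -mulN1r complexImM /=.
  by rewrite oppr0 mul0r addr0 mulN1r oppr_eq0.
exists ('i%C * tau).
  by rewrite normrM tau1 mulr1 normc_def /= expr0n add0r expr1n sqrtr1.
have -> : ('i%C * tau - tau) * (z - tau)^* = ('i%C - 1) * q by rewrite /q; ring.
rewrite complexImM /= qi mulr0 add0r subr0 mul1r.
by apply: contraNneq q0 => qr; rewrite eq_complex qr qi eqxx.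
Qed.

(* The set where [|c| = |d|] being finite, it does not separate the closed
   disc: along infinitely many disjoint curves from [tau] the sign of
   [|d|^2 - |c|^2] would have to change. *)
Lemma norm_le_of_finite_eq (c d e : {poly R[i]}) tau :
  `|tau| = 1 -> c.[tau] = 0 -> d.[tau] = 1 -> e != 0 ->
  (forall z, `|z| <= 1 -> `|c.[z]| = `|d.[z]| -> e.[z] = 0) ->
  forall z, `|z| <= 1 -> `|c.[z]| <= `|d.[z]|.
Proof.
move=> tau1 c0 d1 e0 ecd z z1; rewrite real_leNgt ?normr_real //; apply/negP => dc.
have zt : z != tau.
  by apply: contraTneq dc => ->; rewrite c0 d1 normr0 normr1 ltr10.
have [w w1 delta0] := exists_off_line tau1 zt.
(* This is |d|^2 - |c|^2 along the curve, written with conjugates so that it is visibly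
   differentiable. *)
pose h (u x : R) := let g := (bezier z w tau u).[(x%:C)%C] in
  complex.Re (d.[g] * (d.[g])^*) - complex.Re (c.[g] * (c.[g])^*).
have ReC (v : R[i]) : ((complex.Re (v * v^*))%:C)%C = `|v| ^+ 2.
  by rewrite -normCK RRe_real // ger0_real // exprn_ge0.
have hcont u : continuous (h u).
  move=> x.
  have dg := is_cderive_horner (bezier z w tau u) (is_cderive_real x).
  have [dd _] := is_cderiveM (is_cderive_horner d dg) (is_cderive_conj
    (is_cderive_horner d dg)).
  have [cc _] := is_cderiveM (is_cderive_horner c dg) (is_cderive_conj
    (is_cderive_horner c dg)).
  exact: is_derive_continuous (is_deriveB dd cc).
have h0 u : h u 0 < 0.
  rewrite /h; have -> : (bezier z w tau u).[((0 : R)%:C)%C] = z.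
    by rewrite horner_bezier !(expr0n, mulr0, subr0, mul0r, expr1n, addr0, mul1r).
  by rewrite subr_lt0 -ltcR !ReC ltr_pXn2r ?nnegrE.
have h1 u : 0 < h u 1.
  rewrite /h; have -> : (bezier z w tau u).[((1 : R)%:C)%C] = tau.
    by rewrite horner_bezier !(expr0n, mulr0, subrr, mul0r, expr1n, addr0, mul1r,
      add0r).
  by rewrite c0 d1 conjC1 conjC0 mulr1 mul0r /= subr0.
have root u : exists x, 0 < x < 1 /\ h u x = 0.
  have [|x] := @IVT R (h u) 0 1 0 ler01 (continuous_subspaceT (hcont u)).
    by rewrite minElt maxElt (lt_trans (h0 u) (h1 u)) !ltW.
  rewrite in_itv /= => /andP[x0 x1] hx; exists x; split=> //.
  rewrite !lt_neqAle x0 x1 !andbT; apply/andP; split; apply/eqP => xE.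
    by move: (h0 u); rewrite [in h u 0]xE hx ltxx.
  by move: (h1 u); rewrite -[in h u 1]xE hx ltxx.
have [f fP] := choice root.
pose u (m : nat) : R := m.+1%:R^-1.
have u01 m : 0 <= u m <= 1.
  by rewrite invr_ge0 ler0n invf_le1 ?ltr0n // ler1n.
pose F m := (bezier z w tau (u m)).[((f (u m))%:C)%C].
have F_inj : injective F.
  move=> m l /(bezier_inj delta0) H.
  have /invr_inj/eqP := H (fP _).1 (fP _).1.
  by rewrite eqr_nat eqSS => /eqP.
move/eqP: e0; apply; apply: (poly_injective_roots F_inj) => m.
have [/andP[f0 f1] hf] := fP (u m).
apply: ecd; first by apply: bezier_le1; rewrite ?tau1 // !ltW.
apply/eqP; rewrite -(@eqrXn2 _ 2) // -!ReC; apply/eqP; congr ((_%:C)%C).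
by apply/eqP; rewrite eq_sym -subr_eq0; apply/eqP.
Qed.

End DiscPaths.

(** * Rational maps into the tetrablock *)

Section Continuity.
Variable R : realType.

Section Pointwise.
Variables (T : topologicalType) (p : T).
Implicit Types f g : T -> R[i].

Lemma continuous_atD f g : {for p, continuous f} -> {for p, continuous g} ->
  {for p, continuous (fun x => f x + g x)}.
Proof. by move=> cf cg; exact: (continuousD cf cg). Qed.

Lemma continuous_atM f g : {for p, continuous f} -> {for p, continuous g} ->
  {for p, continuous (fun x => f x * g x)}.
Proof. by move=> cf cg; exact: (continuousM cf cg). Qed.

Lemma continuous_atV f : f p != 0 -> {for p, continuous f} ->
  {for p, continuous (fun x => (f x)^-1)}.
Proof. by move=> fp cf; exact: (@cvgV R[i] T _ _ f _ fp cf). Qed.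

Lemma continuous_at_horner (q : {poly R[i]}) f : {for p, continuous f} ->
  {for p, continuous (fun x => q.[f x])}.
Proof.
move=> cf; elim/poly_ind: q => [|q c IH].
  have -> : (fun x => (0 : {poly R[i]}).[f x]) = cst 0.
    by apply/funext => x; rewrite horner0.
  exact: cst_continuous.
have -> : (fun x => (q * 'X + c%:P).[f x]) = (fun x => q.[f x] * f x + c).
  by apply/funext => x; rewrite hornerMXaddC.
by apply: continuous_atD; [exact: continuous_atM | exact: cst_continuous].
Qed.

Lemma continuous_at_comp (U V : topologicalType) (f : T -> U) (g : U -> V) :
  {for p, continuous f} -> {for f p, continuous g} ->
  {for p, continuous (fun x => g (f x))}.
Proof. by move=> cf cg; exact: (continuous_comp cf cg). Qed.

End Pointwise.

Lemma continuous_conj : continuous (fun z : R[i] => z^*).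
Proof.
move=> z; apply: (iffRL (@cvgrPdist_lt R[i] R[i] R[i] (nbhs z) (nbhs_filter z) _ _))
  => e e0.
have id_cvg : (fun w : R[i] => w) @ nbhs z --> z by [].
have := iffLR (@cvgrPdist_lt R[i] R[i] R[i] (nbhs z) (nbhs_filter z) _ _) id_cvg e e0.
by apply: (@filterS _ _ (nbhs_filter z)) => w; rewrite -rmorphB norm_conjC.
Qed.

Lemma continuous_realC : continuous (fun x : R => (x%:C)%C : R[i]).
Proof.
move=> x; apply: (iffRL (@cvgrPdist_lt R[i] R[i] R (nbhs x) (nbhs_filter x) _ _)) => e
  e0.
have e0' : 0 < complex.Re e by move: e0; rewrite ltcE => /andP[].
have eE : e = ((complex.Re e)%:C)%C by rewrite RRe_real // gtr0_real.
have id_cvg : (fun w : R => w) @ nbhs x --> x by [].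
have := iffLR (@cvgrPdist_lt R R R (nbhs x) (nbhs_filter x) _ _) id_cvg _ e0'.
apply: (@filterS _ _ (nbhs_filter x)) => w.
by rewrite -rmorphB eE normc_def /= expr0n addr0 sqrtr_sqr ltcR.
Qed.

Lemma continuous_cis : continuous (@cis R).
Proof.
move=> t.
have -> : @cis R = fun t => ((cos t)%:C)%C + 'i%C * ((sin t)%:C)%C.
  by apply/funext => u; rewrite [LHS]complexE.
have cc : {for t, continuous (fun u : R => ((cos u)%:C)%C : R[i])}.
  exact: (@continuous_at_comp _ _ R _ _ _ (@continuous_cos R t) (@continuous_realC _)).
have cs : {for t, continuous (fun u : R => ((sin u)%:C)%C : R[i])}.
  exact: (@continuous_at_comp _ _ R _ _ _ (@continuous_sin R t) (@continuous_realC _)).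
have ci : {for t, continuous (fun _ : R => 'i%C : R[i])} by exact: cst_continuous.
exact: (continuous_atD cc (continuous_atM ci cs)).
Qed.

End Continuity.

(** * Quotient maps over a common denominator *)

Section InnerMaps.
Variable R : realType.
Implicit Types (z : R[i]) (p q : {poly R[i]}).

Lemma continuous_at_pair (T U V : topologicalType) (p : T) (f : T -> U) (g : T -> V) :
  {for p, continuous f} -> {for p, continuous g} ->
  {for p, continuous (fun x => (f x, g x))}.
Proof. by move=> cf cg; exact: cvg_pair cf cg. Qed.

Lemma continuous_quotient p q z : q.[z] != 0 ->
  {for z, continuous (fun w : R[i] => p.[w] / q.[w])}.
Proof.
have cid : {for z, continuous (fun w : R[i] => w)} by [].
have cp : {for z, continuous (fun w : R[i] => p.[w])} := continuous_at_horner cid.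
have cq : {for z, continuous (fun w : R[i] => q.[w])} := continuous_at_horner cid.
move=> qz; have cqV : {for z, continuous (fun w : R[i] => (q.[w])^-1)} :=
  continuous_atV qz cq.
exact: (continuous_atM cp cqV).
Qed.

Definition quotient_map (E1 E2 E3 D : {poly R[i]}) z : C3 R :=
  (E1.[z] / D.[z], E2.[z] / D.[z], E3.[z] / D.[z]).

Lemma continuous_quotient_map (E1 E2 E3 D : {poly R[i]}) z : D.[z] != 0 ->
  {for z, continuous (quotient_map E1 E2 E3 D)}.
Proof.
move=> Dz; exact: (continuous_at_pair (continuous_at_pair
  (continuous_quotient (p := E1) Dz) (continuous_quotient (p := E2) Dz))
    (continuous_quotient (p := E3) Dz)).
Qed.

(** A denominator without zeros on the closed disc gives continuity up to the circle, so the radial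
    limit at every circle point is the value there. *)
Lemma quotient_map_inner (E1 E2 E3 D : {poly R[i]}) (x := quotient_map E1 E2 E3 D) :
  (forall z, `|z| <= 1 -> D.[z] != 0) ->
  (forall z, `|z| < 1 -> closed_tetrablock (x z)) ->
  (forall z, `|z| = 1 -> tetra_boundary (x z)) -> tetra_inner x.
Proof.
move=> D0 xin xbd; split => //.
- by split; [exists E1, D | exists E2, D | exists E3, D] => z /ltW /D0.
- apply: aeW => t; exists (x (cis t)); first by apply: xbd; exact: norm_cis.
  apply: cvg_at_left_filter.
  have e1 : (((1 : R)%:C)%C * cis t) = cis t :> R[i] by rewrite rmorph1 mul1r.
  have cl : {for (1 : R), continuous (fun r : R => (r%:C)%C * cis t)}.
    have ct : {for (1 : R), continuous (fun _ : R => cis t : R[i])} by exact: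
      cst_continuous.
    exact: (continuous_atM (@continuous_realC R 1) ct).
  have cx : {for (((1 : R)%:C)%C * cis t), continuous x}.
    by rewrite e1; apply: continuous_quotient_map; rewrite D0 // norm_cis.
  by rewrite -[X in _ --> x X]e1; exact: continuous_at_comp cl cx.
- apply: continuous_in_subspaceT => z; rewrite inE /= => z1.
  exact: continuous_quotient_map (D0 z z1).
Qed.

(* Shrinking the argument of [D] deforms [x3 = z^n conj D / D] to a constant
   multiple of [z^n], and the constant is then rotated to [1]; [x2] is scaled
   to [0] and [x1] follows by the boundary equation. *)
Lemma quotient_map_degree n (E1 E2 E3 D : {poly R[i]}) (x := quotient_map E1 E2 E3 D) :
  (forall z, `|z| <= 1 -> D.[z] != 0) ->
  (forall z, `|z| = 1 -> tetra_boundary (x z)) ->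
  (forall z, `|z| = 1 -> E3.[z] = z ^+ n * (D.[z])^*) ->
  tetra_degree x n.
Proof.
move=> D0 xbd E3E.
have D00 : D.[0] != 0 by rewrite D0 // normr0.
(* At time 1 the shrunk third component is z^n D(0)^* / D(0); this angle cancels the constant. *)
have [th thE] : exists th, cis th = D.[0] / (D.[0])^*.
  by apply: cis_surj; rewrite normf_div norm_conjC divff // normr_eq0.
pose v (p : R * R[i]) := D.[((1 - p.1)%:C)%C * p.2].
pose X2 (p : R * R[i]) := ((1 - p.1)%:C)%C * (E2.[p.2] / D.[p.2]).
pose X3 (p : R * R[i]) := p.2 ^+ n * (v p)^* / v p * cis (p.1 * th).
pose H (p : R * R[i]) : C3 R := ((X2 p)^* * X3 p, X2 p, X3 p).
have v0 t z : 0 <= t <= 1 -> `|z| = 1 -> v (t, z) != 0.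
  move=> /andP[t0 t1] z1; apply: D0; rewrite /= norm_realM ?subr_ge0 //.
  by rewrite z1 mulr1 -(rmorph1 (real_complex R)) lecR gerBl.
exists H; split.
- apply: continuous_in_subspaceT => -[t z]; rewrite inE => -[/= t01 z1].
  pose P : R * R[i] := (t, z).
  have c1 : {for P, continuous (fun p : R * R[i] => p.1)} by exact: cvg_fst.
  have c2 : {for P, continuous (fun p : R * R[i] => p.2)} by exact: cvg_snd.
  have c3 : {for P, continuous (fun p : R * R[i] => 1 - p.1 : R)}.
    have cc : {for P, continuous (fun _ : R * R[i] => 1 : R)} by exact: cst_continuous.
    exact: (continuousB cc c1).
  have cr : {for P, continuous (fun p : R * R[i] => ((1 - p.1)%:C)%C : R[i])}.
    exact: continuous_at_comp c3 (@continuous_realC R _).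
  have cv : {for P, continuous v}.
    exact: continuous_at_horner (continuous_atM cr c2).
  have cX2 : {for P, continuous X2}.
    apply: (continuous_atM cr).
    exact: continuous_at_comp c2 (continuous_quotient (p := E2) (D0 z (norm1_le1 z1))).
  have cX3 : {for P, continuous X3}.
    have ccis : {for P, continuous (fun p : R * R[i] => cis (p.1 * th))}.
      have cth : {for P, continuous (fun _ : R * R[i] => th)} by exact: cst_continuous.
      have cm : {for P, continuous (fun p : R * R[i] => p.1 * th)} by exact:
        (continuousM c1 cth).
      exact: continuous_at_comp cm (@continuous_cis R _).
    have cn : {for P, continuous (fun p : R * R[i] => p.2 ^+ n)}.
      have -> : (fun p : R * R[i] => p.2 ^+ n) = (fun p : R * R[i] => ('X^n : {poly
        R[i]}).[p.2]).
        by apply/funext => p; rewrite hornerXn.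
      exact: continuous_at_horner c2.
    have cvc : {for P, continuous (fun p : R * R[i] => (v p)^*)}.
      exact: continuous_at_comp cv (@continuous_conj R _).
    have cvV : {for P, continuous (fun p : R * R[i] => (v p)^-1)}.
      exact: (continuous_atV (v0 t z t01 z1) cv).
    exact: (continuous_atM (continuous_atM (continuous_atM cn cvc) cvV) ccis).
  have cX2c : {for P, continuous (fun p : R * R[i] => (X2 p)^*)}.
    exact: continuous_at_comp cX2 (@continuous_conj R _).
  exact: (continuous_at_pair (continuous_at_pair (continuous_atM cX2c cX3) cX2) cX3).
- move=> t z t01 z1; split => //=.
    rewrite !normrM normfV norm_conjC norm_cis mulr1 normrX z1 expr1n mul1r.
    by rewrite mulfV // normr_eq0 v0.
  have [_ _ /= x21] := xbd z z1; have /andP[t0 t1] := t01.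
  rewrite norm_realM ?subr_ge0 //; apply: (le_trans _ x21).
  by rewrite ler_piMl // -(rmorph1 (real_complex R)) lecR gerBl.
- move=> z z1; have [/= x1E _ _] := xbd z z1.
  have e2 : X2 (0, z) = E2.[z] / D.[z] by rewrite /X2 /= subr0 rmorph1 mul1r.
  have e3 : X3 (0, z) = E3.[z] / D.[z].
    by rewrite /X3 /v /= subr0 rmorph1 !mul1r mul0r cis0 mulr1 E3E.
  by rewrite /H e2 e3 -x1E.
- move=> z z1.
  have e2 : X2 (1, z) = 0 by rewrite /X2 /= subrr rmorph0 mul0r.
  have e3 : X3 (1, z) = z ^+ n.
    rewrite /X3 /v /= subrr rmorph0 !mul0r mul1r thE.
    by field; rewrite ?conjC_eq0 ?D00.
  by rewrite /H e2 e3 conjC0 mul0r.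
Qed.

End InnerMaps.

(** * The interpolating tetra-inner function *)

Section Solutions.
Variables (R : realType) (n k : nat) (hk : (k <= n)%N).
Variables (sigma eta : 'I_n -> R[i]) (rho : 'I_k -> R).

(** The identification with a Blaschke fraction removes the exceptional points: [q] has no zero on
    the closed disc and the quotient formula holds throughout. *)
Lemma blaschke_quotient_pair (p q : {poly R[i]}) (phi : R[i] -> R[i]) :
  (size p <= n.+1)%N -> blaschke_product n phi ->
  is_quotient phi (fun z => p.[z]) (fun z => q.[z]) ->
  inner_pair n p q /\ forall z, `|z| <= 1 -> phi z = p.[z] / q.[z].
Proof.
move=> szp [gamma [alpha [g1 a1 phiE]]] [s sE].
have pq z : `|z| <= 1 -> z \notin s -> q.[z] != 0 /\
    gamma * \prod_(i < n) ((z - alpha i) / (1 - (alpha i)^* * z)) = p.[z] / q.[z].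
  by move=> z1 zs; have [q0 E] := sE z z1 zs; split=> //; rewrite -phiE.
have [m [m0 pE qE]] := blaschke_quotient g1 a1 szp pq.
split; first exact: blaschke_inner_pair g1 a1 m0 pE qE.
move=> z z1; have d0 := blaschke_den_neq0 a1 z1.
rewrite phiE // pE qE prodf_div -horner_blaschke_num -horner_blaschke_den !hornerZ.
by field; rewrite d0 m0.
Qed.

Hypotheses (sigma_cd : in_circle_disc k sigma).

(** The interpolation and phasar conditions become linear in the pair (p, q), so that along a pencil
    they can be compared coefficientwise in zeta. *)
Lemma solution_pair (p q : {poly R[i]}) (phi : R[i] -> R[i]) :
  (size p <= n.+1)%N -> blaschke_solution hk sigma eta rho phi ->
  is_quotient phi (fun z => p.[z]) (fun z => q.[z]) ->
  [/\ inner_pair n p q, forall z, `|z| <= 1 -> phi z = p.[z] / q.[z],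
      forall j, p.[sigma j] = eta j * q.[sigma j]
    & forall j : 'I_k, let s := sigma (widen_ord hk j) in
        let h := eta (widen_ord hk j) in
        s * (p^`().[s] - h * q^`().[s]) = ((rho j)%:C)%C * h * q.[s]].
Proof.
move=> szp [phiB phiS phiA] phiQ.
have [ipq phiE] := blaschke_quotient_pair szp phiB phiQ; have [q0 _ _] := ipq.
split=> //= j.
  have s1 := node_le1 sigma_cd j.
  by rewrite -phiS phiE // divfK // q0.
rewrite -phiS; apply: phasar_quotient_deriv (phiA j) _ => z z1.
by rewrite q0 ?z1 // phiE ?z1 // (inner_pair_circle ipq).
Qed.

End Solutions.

(** * The map built from a normalized parametrization *)

Section Construction.
Variables (R : realType) (n k : nat) (hk : (k <= n)%N).
Variables (sigma eta teta : 'I_n -> R[i]) (rho : 'I_k -> R).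
Variables (a b c d : {poly R[i]}) (tau : R[i]) (s : seq R[i]).
Hypotheses (sigma_inj : injective sigma) (sigma_cd : in_circle_disc k sigma).
Hypotheses (eta_cd : in_circle_disc k eta) (teta_cd : in_circle_disc k teta).
Hypotheses (sz_a : (size a <= n.+1)%N) (sz_b : (size b <= n.+1)%N)
  (sz_c : (size c <= n.+1)%N) (sz_d : (size d <= n.+1)%N).
Hypothesis solutions : forall zeta, `|zeta| = 1 -> zeta \notin s ->
  exists phi, blaschke_solution hk sigma eta rho phi /\
    is_quotient phi (fun z => a.[z] * zeta + b.[z]) (fun z => c.[z] * zeta + d.[z]).
Hypotheses (tau1 : `|tau| = 1) (a1 : a.[tau] = 1) (b0 : b.[tau] = 0)
  (c0 : c.[tau] = 0) (d1 : d.[tau] = 1).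

Lemma good_solution zeta : `|zeta| = 1 -> zeta \notin s ->
  let p := zeta *: a + b in let q := zeta *: c + d in
  exists phi, [/\ blaschke_solution hk sigma eta rho phi, inner_pair n p q,
    forall z, `|z| <= 1 -> phi z = p.[z] / q.[z],
      forall j, p.[sigma j] = eta j * q.[sigma j]
    & forall j : 'I_k, let s := sigma (widen_ord hk j) in
        let h := eta (widen_ord hk j) in
        s * (p^`().[s] - h * q^`().[s]) = ((rho j)%:C)%C * h * q.[s]].
Proof.
move=> zeta1 zs p q; have [phi [phiS phiQ]] := solutions zeta1 zs.
exists phi; have szp : (size p <= n.+1)%N.
  by rewrite (leq_trans (size_polyD _ _)) // geq_max sz_b (leq_trans (size_scale_leq _
    _)).
have [] := solution_pair sigma_cd szp phiS (q := q) => //.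
case: phiQ => r rE; exists r => z z1 zr; have := rE z z1 zr.
by rewrite !hornerE ![zeta * _]mulrC.
Qed.

Lemma good_pair zeta : `|zeta| = 1 -> zeta \notin s ->
  inner_pair n (zeta *: a + b) (zeta *: c + d).
Proof. by move=> z1 zs; have [phi []] := good_solution z1 zs. Qed.

Let circle_values := pencil_circle tau1 a1 b0 c0 d1 good_pair.

Lemma pencil_nodes j :
  a.[sigma j] = eta j * c.[sigma j] /\ b.[sigma j] = eta j * d.[sigma j].
Proof.
apply: (@affine_circle_inj _ s) => zeta zeta1 zs.
have [phi [_ _ _ /(_ j) + _]] := good_solution zeta1 zs.
by rewrite !hornerE => E; rewrite [LHS]addrC mulrC addrC E; ring.
Qed.

Lemma pencil_deriv_nodes (j : 'I_k) :
  let t := sigma (widen_ord hk j) in let h := eta (widen_ord hk j) in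
  t * (a^`().[t] - h * c^`().[t]) = ((rho j)%:C)%C * h * c.[t] /\
  t * (b^`().[t] - h * d^`().[t]) = ((rho j)%:C)%C * h * d.[t].
Proof.
move=> t h; apply: (@affine_circle_inj _ s) => zeta zeta1 zs.
have [phi [_ _ _ _ /(_ j) /=]] := good_solution zeta1 zs.
rewrite -/t -/h !derivD !derivZ !hornerE => E.
transitivity (t * (zeta * a^`().[t] + b^`().[t] - h * (zeta * c^`().[t] + d^`().[t]))).
  by ring.
by rewrite E; ring.
Qed.

Lemma pencil_c_le_d z : `|z| <= 1 -> `|c.[z]| <= `|d.[z]| /\ d.[z] != 0.
Proof.
have zero y := pencil_zero good_pair (z := y).
move=> z1; have cd : `|c.[z]| <= `|d.[z]|.
  have ecd y : `|y| <= 1 -> `|c.[y]| = `|d.[y]| -> (pencil_exceptional c d s).[y] = 0.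
    by move=> y1 E; have [] := zero y y1 E.
  exact: (norm_le_of_finite_eq tau1 c0 d1 (pencil_exceptional_neq0 s c0 d1) ecd).
split=> //; apply/eqP => dz; move: cd; rewrite dz normr0 normr_le0 => /eqP cz.
have [|] := zero z z1; first by rewrite cz dz.
by rewrite dz eqxx.
Qed.

(** At a node both columns of the matrix are multiples of (eta, 1), so the determinant vanishes; at
    a circle node the phasar relations make its derivative vanish too. *)
Lemma pencil_det : exists C,
  a * d - b * c = C *: (blaschke_num sigma * blaschke_den sigma).
Proof.
apply: (self_reflective_factor sigma_inj sigma_cd (tau := tau)) => //.
- have szM (p q : {poly R[i]}) : (size p <= n.+1)%N -> (size q <= n.+1)%N ->
      (size (p * q)%R <= n + n.+1)%N.
    move=> szp szq; rewrite (leq_trans (size_mul_leq _ _)) //.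
    by rewrite -subn1 leq_subLR add1n -addSn leq_add.
  by rewrite (leq_trans (size_polyD _ _)) // geq_max size_polyN !szM.
(* On the circle the determinant is t (|d|^2 - |c|^2), with a real second factor and |t| = 1. *)
- move=> z z1; have [aE bE] := circle_values z1; set t := (z / tau) ^+ n in aE bE *.
  have tt : t * t^* = 1.
    by rewrite -normCK normrX normf_div z1 tau1 divr1 !expr1n.
  rewrite exprD -/t !hornerE aE bE !rmorphB !rmorphM /= !conjCK.
  transitivity (t * (t * t^*) * (d.[z]^* * d.[z] - c.[z]^* * c.[z])); last by ring.
  by rewrite tt; ring.
- by move=> j; have [aj bj] := pencil_nodes j; rewrite !hornerE aj bj; ring.
- move=> j jk; have jE : j = widen_ord hk (Ordinal jk) by apply: val_inj.
  rewrite jE; have [aj bj] := pencil_nodes (widen_ord hk (Ordinal jk)).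
  have [/= daj dbj] := pencil_deriv_nodes (Ordinal jk).
  set t := sigma _ in aj bj daj dbj *; set h := eta _ in aj bj daj dbj.
  have t0 : t != 0.
    by apply: norm1_neq0; apply/eqP; rewrite (node_circleE sigma_cd).
  apply: (mulfI t0); rewrite mulr0 derivB !derivM !hornerE aj bj.
  transitivity (d.[t] * (t * (a^`().[t] - h * c^`().[t]))
     - c.[t] * (t * (b^`().[t] - h * d^`().[t]))); first by ring.
  by rewrite daj dbj; ring.
Qed.


Variables (x1o x2o x3o : R[i]).
Hypotheses (x3o1 : `|x3o| = 1) (x1o1 : `|x1o| < 1) (x2o1 : `|x2o| < 1)
  (x1oE : x1o = x2o^* * x3o).
Hypothesis teta_eq : forall j : 'I_n,
  (x3o * c.[sigma j] + x2o * d.[sigma j]) /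
  (x1o * c.[sigma j] + d.[sigma j]) = teta j.

(* This normalization makes the numerator of [x3] the reflection of the common
   denominator. *)
Definition kappa := sqrtC (tau ^+ n * x3o^*).

Definition tetra_num1 := kappa *: (x1o *: a + b).
Definition tetra_num2 := kappa *: (x3o *: c + x2o *: d).
Definition tetra_num3 := kappa *: (x2o *: b + x3o *: a).
Definition tetra_den := kappa *: (x1o *: c + d).

Definition tetra_map := quotient_map tetra_num1 tetra_num2 tetra_num3 tetra_den.

Lemma kappa_sqr : kappa ^+ 2 = tau ^+ n * x3o^*.
Proof. exact: sqrtCK. Qed.

Lemma norm_kappa : `|kappa| = 1.
Proof.
apply/eqP; rewrite -(@pexpr_eq1 _ _ 2) // -normrX kappa_sqr normrM norm_conjC.
by rewrite normrX tau1 expr1n x3o1 mulr1.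
Qed.

Lemma kappa_neq0 : kappa != 0.
Proof. exact: norm1_neq0 norm_kappa. Qed.

Lemma kappa_conj : kappa^* * (tau ^+ n * x3o^*) = kappa.
Proof. by rewrite -kappa_sqr (norm1_conjC norm_kappa) expr2 mulKf ?kappa_neq0. Qed.

Lemma x3o_conj : x3o * x3o^* = 1.
Proof. by rewrite -normCK x3o1 expr1n. Qed.

Lemma x1o_conj : x1o^* = x2o * x3o^*.
Proof. by rewrite x1oE rmorphM /= conjCK. Qed.

Lemma x2o_conj : x2o^* = x1o * x3o^*.
Proof. by rewrite x1oE -mulrA x3o_conj mulr1. Qed.

Lemma pencil_den_neq0 z : `|z| <= 1 -> x1o * c.[z] + d.[z] != 0.
Proof.
by move=> z1; have [cd dz] := pencil_c_le_d z1; rewrite mulrC linear_neq0.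
Qed.

Lemma tetra_den_neq0 z : `|z| <= 1 -> tetra_den.[z] != 0.
Proof. by move=> z1; rewrite !hornerE mulf_neq0 ?kappa_neq0 // pencil_den_neq0. Qed.

Lemma tetra_mapE z : tetra_map z =
  ((x1o * a.[z] + b.[z]) / (x1o * c.[z] + d.[z]),
   (x3o * c.[z] + x2o * d.[z]) / (x1o * c.[z] + d.[z]),
   (x2o * b.[z] + x3o * a.[z]) / (x1o * c.[z] + d.[z])).
Proof.
by rewrite /tetra_map /quotient_map !hornerE -!mulf_div !divff ?kappa_neq0 // !mul1r.
Qed.

Lemma tau_circle z : `|z| = 1 -> z ^+ n * (d.[z])^* = tau ^+ n * a.[z] /\
  z ^+ n * (c.[z])^* = tau ^+ n * b.[z].
Proof.
move=> z1; have [-> ->] := circle_values z1; rewrite expr_div_n.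
by split; field; rewrite expf_neq0 // norm1_neq0.
Qed.

Lemma tetra_num3_circle z : `|z| = 1 -> tetra_num3.[z] = z ^+ n * (tetra_den.[z])^*.
Proof.
move=> z1; have [dE cE] := tau_circle z1.
rewrite !hornerE !(rmorphM, rmorphD) /= x1o_conj.
transitivity (kappa^* * (x2o * x3o^* * (z ^+ n * (c.[z])^*) + z ^+ n * (d.[z])^*));
  last by ring.
rewrite dE cE -[X in X * _ = _]kappa_conj.
transitivity (kappa^* * tau ^+ n * (x3o^* * x2o * b.[z] + x3o * x3o^* * a.[z]));
  first by ring.
by rewrite x3o_conj; ring.
Qed.

Lemma tetra_num1_circle z : `|z| = 1 -> tetra_num1.[z] = z ^+ n * (tetra_num2.[z])^*.
Proof.
move=> z1; have [dE cE] := tau_circle z1.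
rewrite !hornerE !(rmorphM, rmorphD) /= x2o_conj.
transitivity (kappa^* * (x3o^* * (z ^+ n * (c.[z])^*) + x1o * x3o^* * (z ^+ n *
  (d.[z])^*))); last by ring.
by rewrite dE cE -[X in X * _ = _]kappa_conj; ring.
Qed.

(** The first two clauses express that [tetra_num1] and [tetra_num3] are the reflections of
    [tetra_num2] and [tetra_den]. The third reduces to |c| <= |d| by an identity with factor 1 -
    |x2o|^2. *)
Lemma tetra_map_boundary z : `|z| = 1 -> tetra_boundary (tetra_map z).
Proof.
move=> z1; have D0 := tetra_den_neq0 (norm1_le1 z1); split.
- change (tetra_num1.[z] / tetra_den.[z] = (tetra_num2.[z] / tetra_den.[z])^* *
  (tetra_num3.[z] / tetra_den.[z])).
  rewrite tetra_num1_circle // tetra_num3_circle // rmorphM fmorphV /=.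
  by field; rewrite conjC_eq0 D0.
- change (`|tetra_num3.[z] / tetra_den.[z]| = 1).
  rewrite tetra_num3_circle // normf_div normrM norm_conjC normrX z1 expr1n mul1r.
  by rewrite divff // normr_eq0.
- rewrite tetra_mapE /= normf_div ler_pdivrMr ?normr_gt0 ?pencil_den_neq0 ?z1 // mul1r.
  have [cd _] := pencil_c_le_d (norm1_le1 z1).
  rewrite -(@ler_pXn2r _ 2) ?nnegrE // !normCK -subr_ge0.
  rewrite !(rmorphM, rmorphD) /= x1o_conj x1oE.
  have -> : (x2o^* * x3o * c.[z] + d.[z]) * (x2o * x3o^* * c.[z]^* + d.[z]^*)
    - (x3o * c.[z] + x2o * d.[z]) * (x3o^* * c.[z]^* + x2o^* * d.[z]^*) =
    (1 - x2o * x2o^*) * (d.[z] * d.[z]^* - (x3o * x3o^*) * (c.[z] * c.[z]^*)).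
    by ring: x3o_conj.
  rewrite x3o_conj mul1r -!normCK mulr_ge0 // subr_ge0 ?expr_le1 ?(ltW x2o1) //.
  by rewrite ler_pXn2r ?nnegrE.
Qed.

Lemma tetra_map_tetrablock z : `|z| < 1 -> closed_tetrablock (tetra_map z).
Proof.
move=> z1 u w u1 w1; have z1' := ltW z1; have D0 := pencil_den_neq0 z1'.
have [cd dz] := pencil_c_le_d z1'.
have xw0 : 1 - x2o * w != 0.
  rewrite subr_eq0; apply/eqP => /(congr1 Num.norm); rewrite normr1 normrM => E.
  by have := mulr_ilt1 (normr_ge0 _) (normr_ge0 _) x2o1 w1; rewrite -E ltxx.
pose zeta := (x1o - x3o * w) / (1 - x2o * w).
(* As x1o = x2o^* x3o, [zeta] is [x3o] times a Blaschke factor in [w], up to sign. *)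
have zeta1 : `|zeta| < 1.
  rewrite normf_div ltr_pdivrMr ?normr_gt0 // mul1r.
  rewrite -(@ltr_pXn2r _ 2) ?nnegrE // !normCK -subr_gt0.
  rewrite !(rmorphM, rmorphB, rmorph1) /= x1o_conj x1oE.
  have -> : (1 - x2o * w) * (1 - x2o^* * w^*)
     - (x2o^* * x3o - x3o * w) * (x2o * x3o^* - x3o^* * w^*) =
     (1 - x2o * x2o^*) * (1 - w * w^*).
    by ring: x3o_conj.
  by rewrite -!normCK mulr_gt0 // subr_gt0 expr_lt1.
have := linear_fractional_contract cd dz (fun y y1 => pencil_le good_pair z1' y1)
  zeta1 u1.
have -> : 1 - c1 (tetra_map z) * u - c2 (tetra_map z) * w + c3 (tetra_map z) * u * w =
  (1 - x2o * w) / (x1o * c.[z] + d.[z]) *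
  (c.[z] * zeta + d.[z] - u * (a.[z] * zeta + b.[z])).
  by rewrite tetra_mapE /c1 /c2 /c3 /= /zeta; field; rewrite D0 xw0.
by move=> H; rewrite !mulf_neq0 ?invr_eq0.
Qed.

Lemma tetra_map_inner : tetra_inner tetra_map.
Proof.
exact: quotient_map_inner tetra_den_neq0 tetra_map_tetrablock tetra_map_boundary.
Qed.

Lemma tetra_map_degree : tetra_degree tetra_map n.
Proof. exact: quotient_map_degree tetra_den_neq0 tetra_map_boundary tetra_num3_circle.
  Qed.


Lemma tetra_map_nodes j :
  tetra_map (sigma j) = (eta j, teta j, eta j * teta j).
Proof.
have [aj bj] := pencil_nodes j.
have D0 := pencil_den_neq0 (node_le1 sigma_cd j).
rewrite tetra_mapE teta_eq -(teta_eq j) aj bj.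
by congr (_, _, _); field.
Qed.

Lemma royal_det_neq0 : x3o - x1o * x2o != 0.
Proof.
rewrite subr_eq0; apply/eqP => /(congr1 Num.norm).
rewrite x3o1 normrM => E.
by have := mulr_ilt1 (normr_ge0 _) (normr_ge0 _) x1o1 x2o1; rewrite -E ltxx.
Qed.

Lemma size_tetra_num (x y : R[i]) (p q : {poly R[i]}) :
  (size p <= n.+1)%N -> (size q <= n.+1)%N ->
  (size (kappa *: (x *: p + y *: q)) <= n.+1)%N.
Proof.
move=> szp szq; rewrite (leq_trans (size_scale_leq _ _)) //.
rewrite (leq_trans (size_polyD _ _)) // geq_max.
by rewrite !(leq_trans (size_scale_leq _ _)).
Qed.

Lemma size_tetra_den : (size tetra_den <= n.+1)%N.
Proof. by rewrite /tetra_den -[d]scale1r size_tetra_num. Qed.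

Lemma reflection_tetra_den : reflection n tetra_den = tetra_num3.
Proof.
apply: (@poly_circle_eq _ [::]) => z z1 _; rewrite tetra_num3_circle //.
exact: horner_reflection size_tetra_den z1.
Qed.

Lemma royal_polynomialE : royal_polynomial n tetra_num1 tetra_num2 tetra_den =
  (kappa ^+ 2 * (x3o - x1o * x2o)) *: (a * d - b * c).
Proof.
rewrite /royal_polynomial reflection_tetra_den /tetra_num1 /tetra_num2 /tetra_num3
  /tetra_den -!mul_polyC.
by rewrite polyCM rmorphXn rmorphB rmorphM /=; ring.
Qed.

(** The constant is nonzero because a d - b c equals 1 at [tau] and |x1o x2o| < 1 = |x3o|. *)
Lemma royal_factor : exists2 K, K != 0 & royal_polynomial n tetra_num1 tetra_num2
  tetra_den =
  K *: (blaschke_num sigma * blaschke_den sigma).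
Proof.
have [K KE] := pencil_det; exists (kappa ^+ 2 * (x3o - x1o * x2o) * K).
  rewrite !mulf_neq0 ?kappa_neq0 ?expf_neq0 ?royal_det_neq0 //.
  apply/eqP => K0; have := congr1 (horner^~ tau) KE.
  by rewrite K0 scale0r !hornerE a1 b0 c0 d1 mulr1 mul0r subr0 => /eqP;
    rewrite oner_eq0.
by rewrite royal_polynomialE KE scalerA.
Qed.

(** A disc node is a simple zero; a circle node is a double zero whose order is halved. *)
Lemma royal_multiplicity_node j :
  royal_multiplicity (royal_polynomial n tetra_num1 tetra_num2 tetra_den) (sigma j) = 1.
Proof.
have [K K0 ->] := royal_factor; rewrite /royal_multiplicity -mul_polyC.
rewrite mupMr ?rootC // (mup_blaschke_nodes sigma_inj sigma_cd).
by case: (_ < 1)%R; rewrite ?divff.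
Qed.

Lemma royal_node_tetra_map z : royal_node tetra_map z <-> z \in codom sigma.
Proof.
split=> [[z1 [_]]|/codomP[j ->]].
  have D0 := tetra_den_neq0 z1.
  move=> E; have {}E : tetra_num3.[z] / tetra_den.[z] = tetra_num1.[z] / tetra_den.[z]
    * (tetra_num2.[z] / tetra_den.[z]) by [].
  have [K K0 KE] := royal_factor.
  suff : (royal_polynomial n tetra_num1 tetra_num2 tetra_den).[z] = 0.
    rewrite KE hornerZ => /eqP;
      rewrite mulf_eq0 (negPf K0) => /eqP/(blaschke_nodes_root sigma_cd z1).
    by case=> j ->; apply: codom_f.
  rewrite /royal_polynomial reflection_tetra_den hornerD hornerN !hornerM.
  by rewrite -(divfK D0 tetra_num3.[z]) E; field.
have [h1 t1] : `|eta j| <= 1 /\ `|teta j| <= 1 by split;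
  [exact: node_le1 eta_cd j | exact: node_le1 teta_cd j].
split; first exact: node_le1 sigma_cd j.
rewrite tetra_map_nodes; split=> // u w u1 w1 /=.
rewrite /c1 /c2 /c3 /=.
have F (h v : R[i]) : `|h| <= 1 -> `|v| < 1 -> 1 - h * v != 0.
  move=> h1' v1; rewrite subr_eq0; apply/eqP => /(congr1 Num.norm).
  rewrite normr1 normrM => E; have := ler_piMl (normr_ge0 v) h1'.
  by rewrite -E => /(lt_le_trans v1); rewrite ltxx.
(* A triple (h, v, h v) with |h|, |v| <= 1 lies in the tetrablock because the defining polynomial
   splits. *)
have -> : 1 - eta j * u - teta j * w + eta j * teta j * u * w =
  (1 - eta j * u) * (1 - teta j * w) by ring.
by rewrite mulf_neq0 ?F.
Qed.

Lemma tetra_map_royal_type : royal_type tetra_map n k.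
Proof.
exists n, tetra_num1, tetra_num2, tetra_den, (codom sigma); split.
- exact: tetra_map_degree.
- split.
  + by split; rewrite ?size_tetra_den ?size_tetra_num // /tetra_num1 -[b]scale1r
    size_tetra_num.
  + exact: tetra_den_neq0.
  + move=> z z1; rewrite /tetra_map /quotient_map reflection_tetra_den //.
- split; first by rewrite map_inj_uniq ?enum_uniq.
  by move=> z; apply: iff_sym; apply: royal_node_tetra_map.
- rewrite big_map enumT; under eq_bigr do rewrite royal_multiplicity_node.
  by rewrite sumr_const card_ord.
- rewrite big_map enumT; under eq_big => [j|j _].
    rewrite (node_circleE sigma_cd); over.
    rewrite royal_multiplicity_node; over.
  by rewrite -(big_ord_widen _ (fun=> 1)) // sumr_const card_ord.
Qed.

(** The value at [tau] is (x1o, x2o, x3o), which is off the royal variety. *)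
Lemma tetra_map_royal_class : royal_class n k tetra_map.
Proof.
split; [exact: tetra_map_inner | | exact: tetra_map_royal_type].
move=> /(_ (tetra_map tau)) [|_]; first by exists tau => //=; rewrite tau1.
rewrite tetra_mapE a1 b0 c0 d1 /c1 /c2 /c3 /=.
rewrite !(mulr0, mulr1, add0r, addr0, divr1) => /eqP.
by rewrite -subr_eq0 (negPf royal_det_neq0).
Qed.

(** The phasar relation is linear in numerator and denominator, so the relations for (a, c) and (b,
    d) combine with coefficients kappa x1o and kappa, although [x1o] is not on the circle. *)
Lemma tetra_map_phasar j : phasar_derivative (c1 \o tetra_map) (sigma (widen_ord hk
  j)) (rho j).
Proof.
set t := sigma _; have [aj bj] := pencil_nodes (widen_ord hk j).
have [/= daj dbj] := pencil_deriv_nodes j.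
have jk : (widen_ord hk j < k)%N by rewrite /=.
have fE : c1 (tetra_map t) = eta (widen_ord hk j) by rewrite tetra_map_nodes.
apply: (@quotient_phasar _ tetra_num1 tetra_den).
- by move: (sigma_cd (widen_ord hk j)); rewrite jk.
- by move=> z z1; split; rewrite ?tetra_den_neq0 ?z1.
- by rewrite /= fE; move: (eta_cd (widen_ord hk j)); rewrite jk.
rewrite [(c1 \o _) t]fE /tetra_num1 /tetra_den !derivZ !derivD !derivZ !(hornerZ,
  hornerD).
rewrite -/t in daj dbj; set h := eta _ in daj dbj *.
transitivity (kappa * (x1o * (t * (a^`().[t] - h * c^`().[t])) + t * (b^`().[t] - h *
  d^`().[t]))).
  by ring.
by rewrite daj dbj; ring.
Qed.

Lemma tetra_map_royal_solution : royal_solution hk sigma eta teta rho tetra_map.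
Proof.
split; [exact: tetra_map_inner | exact: tetra_map_degree
  | exact: tetra_map_nodes | exact: tetra_map_phasar].
Qed.

Lemma tetra_map_Psi : exists r : seq R[i], forall omega : R[i], `|omega| = 1 ->
  omega \notin r -> exists phi, is_Psi_comp omega tetra_map phi /\
    blaschke_solution hk sigma eta rho phi.
Proof.
(* The excluded omega are the preimages of [s] under omega |-> (x3o omega - x1o) / (x2o omega -
   1). *)
exists [seq (x1o - zeta) / (x3o - zeta * x2o) | zeta <- s] => omega om1 om_r.
have N0 (v w : R[i]) : `|v| < 1 -> `|w| = 1 -> v * w - 1 != 0.
  move=> v1 w1; rewrite subr_eq0; apply/eqP => /(congr1 Num.norm).
  by rewrite normr1 normrM w1 mulr1 => E; rewrite E ltxx in v1.
have xo0 := N0 _ _ x2o1 om1.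
pose zeta := (x3o * omega - x1o) / (x2o * omega - 1).
have oo : omega * omega^* = 1 by rewrite -normCK om1 expr1n.
have zeta1 : `|zeta| = 1.
  rewrite normf_div -[X in _ / X]norm_conjC.
  (* The boundary relation between [x1o] and [x2o] makes numerator and denominator of [zeta] equal
     in modulus. *)
  have -> : x3o * omega - x1o = - (x3o * omega) * ((x2o * omega - 1)^*).
    rewrite rmorphB rmorphM rmorph1 x1oE /=.
    transitivity (x3o * omega - x2o^* * x3o * (omega * omega^*)); last by ring.
    by rewrite oo mulr1.
  by rewrite normrM normrN normrM x3o1 om1 !mul1r divff // norm_conjC normr_eq0.
have zs : zeta \notin s.
  apply: contra om_r => zs; apply/mapP; exists zeta => //.
  have y0 : x3o - zeta * x2o != 0.
    rewrite subr_eq0; apply/eqP => /(congr1 Num.norm).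
    by rewrite normrM x3o1 zeta1 mul1r => E; have := x2o1; rewrite -E ltxx.
  have zE : zeta * (x2o * omega - 1) = x3o * omega - x1o by rewrite /zeta divfK.
  apply: (mulIf y0); rewrite divfK //.
  transitivity (x1o - zeta + (x3o * omega - x1o) - zeta * (x2o * omega - 1));
    last first.
    by rewrite zE; ring.
  by ring.
have [phi [phiS [q0 _ _] phiE _ _]] := good_solution zeta1 zs.
(* No point is excluded: x2 omega - 1 is a nonzero multiple of zeta c + d, which has no zero on the
   closed disc. *)
exists phi; split=> //; exists [::] => z z1 _;
  rewrite phiE // tetra_mapE /Psi /c1 /c2 /c3 /=.
have D0 := pencil_den_neq0 z1; have := q0 z z1; rewrite !hornerE => Q0.
have E : (x3o * c.[z] + x2o * d.[z]) / (x1o * c.[z] + d.[z]) * omega - 1 =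
   (x2o * omega - 1) * (zeta * c.[z] + d.[z]) / (x1o * c.[z] + d.[z]).
  by rewrite /zeta; field; rewrite xo0 D0.
split; first by rewrite -subr_eq0 E !mulf_neq0 ?invr_eq0.
have E' : (x2o * b.[z] + x3o * a.[z]) / (x1o * c.[z] + d.[z]) * omega -
    (x1o * a.[z] + b.[z]) / (x1o * c.[z] + d.[z]) =
   (x2o * omega - 1) * (zeta * a.[z] + b.[z]) / (x1o * c.[z] + d.[z]).
  by rewrite /zeta; field; rewrite xo0 D0.
rewrite E E'; move: (zeta * c.[z] + d.[z]) Q0 => M M0.
by field; rewrite M0 xo0 D0.
Qed.

End Construction.

Theorem theorem6p4 (R : realType) (n k : nat) (hn : (1 <= n)%N)
    (hk : (k <= n)%N) (sigma eta teta : 'I_n -> R[i]) (rho : 'I_k -> R)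
    (a b c d : {poly R[i]}) (x1o x2o x3o : R[i]) :
  blaschke_data sigma eta rho ->
  royal_data sigma eta teta rho ->
  (exists phi, blaschke_solution hk sigma eta rho phi) ->
  normalized_parametrization hk sigma eta rho a b c d ->
  `|x3o| = 1 -> `|x1o| < 1 -> `|x2o| < 1 -> x1o = x2o^* * x3o ->
  (forall j : 'I_n,
     (x3o * c.[sigma j] + x2o * d.[sigma j]) /
     (x1o * c.[sigma j] + d.[sigma j]) = teta j) ->
  exists x : R[i] -> C3 R,
    [/\ tetra_inner x,
        forall z : R[i], `|z| < 1 ->
          x1o * c.[z] + d.[z] != 0 /\
          x z = ((x1o * a.[z] + b.[z]) / (x1o * c.[z] + d.[z]),
                 (x3o * c.[z] + x2o * d.[z]) / (x1o * c.[z] + d.[z]),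
                 (x2o * b.[z] + x3o * a.[z]) / (x1o * c.[z] + d.[z])),
        royal_class n k x /\ royal_solution hk sigma eta teta rho x
      & exists s : seq R[i], forall omega : R[i], `|omega| = 1 ->
          omega \notin s ->
          exists phi, is_Psi_comp omega x phi /\
            blaschke_solution hk sigma eta rho phi].
Proof.
move=> [sigma_inj sigma_cd eta_cd _] [_ teta_cd] _.
move=> [[sz_a sz_b sz_c sz_d] [s [_ solutions]] [tau [tau1 _ [a1 b0 c0 d1]]] _].
move=> x3o1 x1o1 x2o1 x1oE teta_eq.
exists (tetra_map n a b c d tau x1o x2o x3o); split.
- exact: (tetra_map_inner sigma_cd sz_a sz_b solutions).
- move=> z /ltW z1; split; last exact: tetra_mapE.
  exact: (pencil_den_neq0 sigma_cd sz_a sz_b solutions tau1).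
- split.
    exact: (tetra_map_royal_class sigma_inj sigma_cd eta_cd teta_cd _ _ _ _ solutions).
  exact: (tetra_map_royal_solution sigma_cd eta_cd sz_a sz_b solutions).
- exact: (tetra_map_Psi sigma_cd sz_a sz_b solutions).
Qed.
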